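(* Let $X$ be a smooth $n$-dimensional manifold. All functions $f,F,h,f_n,g_n$ below are compactly supported. (a) Let $\lambda:C^{\infty}(X)\to C^{\infty}(X)$ be a differential operator of the first order and let $f:X\to\mathbb{R}$ be a smooth function. Assume that $\lambda(f)$ attains its maximum at a point $x$ which is a non-degenerate critical point of $\lambda(f)$. Let $U\subset X$ be an arbitrary open neighborhood of $x$. Then, for any smooth function $F:X\to\mathbb{R}$ satisfying $\|F-f\|_U\leqslant\varepsilon$, we have $$\sup_U\lambda(F)\;\geqslant\;\lambda(f)(x)-\Big(\frac92\Big)^{1/3}\big(-\lambda^3(f)(x)\big)^{1/3}\varepsilon^{2/3}-O(\varepsilon).$$ (b) Let $B(\cdot,\cdot):C^{\infty}(X)\times C^{\infty}(X)\to C^{\infty}(X)$ be a bilinear differential operator of the first order which is not antisymmetric. Then there exist a function $h\in C^{\infty}(X)$ and sequences $f_n,g_n\in C^{\infty}(X)$ with $\|f_n-h\|\to0$, $\|g_n-h\|\to0$, such that $B(h,h)\neq0$ (i.e. $B(h,h)$ is not identically zero) and $B(f_n,g_n)=0$ for every $n$.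
   Context: $\|h\|=\sup_X|h|$ is the uniform norm and $\|h\|_U=\sup_{U}|h|$. A (linear) differential operator of the first order $\lambda$ is one of the form $\lambda(f)=df(v)$ for a smooth vector field $v$ on $X$ (no zeroth-order term); $\lambda^3=\lambda\circ\lambda\circ\lambda$. A bilinear differential operator of the first order is one which is a first-order differential operator in this sense in each argument, i.e. $B(f,g)(x)$ is a bilinear form in $(df_x,dg_x)$ depending smoothly on $x$. The term $O(\varepsilon)$ in (a) is as $\varepsilon\to0^+$ and is uniform in $F$: there are constants $K,\varepsilon_0>0$ depending only on $X,\lambda,f,x,U$ such that for all $0<\varepsilon<\varepsilon_0$ and all such $F$ the inequality holds with $O(\varepsilon)$ replaced by $K\varepsilon$. *)

(* Defs.v *)
From HB Require Import structures.
From mathcomp Require Export all_boot all_order all_algebra.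
From mathcomp Require Export all_classical all_reals all_analysis.
Export Order.TTheory GRing.Theory Num.Theory.
Export numFieldNormedType.Exports.

Set Implicit Arguments.
Unset Strict Implicit.
Unset Printing Implicit Defensive.

Local Open Scope classical_set_scope.
Local Open Scope ring_scope.

(* All notions on R^n below are only used on open sets [A], so that continuity
   and derivability at the points of [A] do not depend on the values outside. *)
Section Euclidean.
Context {R : realType} {n : nat}.

Definition partial (i : 'I_n) (f : 'rV[R]_n -> R) : 'rV[R]_n -> R :=
  'D_(delta_mx 0 i) f.

Fixpoint Ck (k : nat) (A : set 'rV[R]_n) (f : 'rV[R]_n -> R) : Prop :=
  {in A, continuous f} /\
  match k with
  | 0 => True
  | k'.+1 => forall i : 'I_n,
      {in A, forall p, derivable f p (delta_mx 0 i)} /\ Ck k' A (partial i f)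
  end.

Definition smooth_on (A : set 'rV[R]_n) (f : 'rV[R]_n -> R) : Prop :=
  forall k, Ck k A f.

End Euclidean.

(* A chart is a homeomorphism from the open set [dom] onto an open subset of
   R^n; [coord] and [cinv] are total functions whose values outside [dom] and
   outside [coord @` dom] are irrelevant. *)
Record chart (R : realType) (X : topologicalType) (n : nat) := Chart {
  dom : set X;
  coord :> X -> 'rV[R]_n;
  cinv : 'rV[R]_n -> X;
  open_dom : open dom;
  open_coord : open (coord @` dom);
  coord_continuous : {in dom, continuous coord};
  cinv_continuous : {in coord @` dom, continuous cinv};
  coordK : {in dom, cancel coord cinv} }.

(* [chart_at y] is a preferred chart around [y]: the tangent space at [y] is
   'rV[R]_n and the cotangent space is 'cV[R]_n, both read in the coordinates
   of [chart_at y]. *)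
Record manifold (R : realType) (n : nat) := Manifold {
  carrier :> topologicalType;
  carrier_hausdorff : hausdorff_space carrier;
  carrier_second_countable : @second_countable carrier;
  atlas : set (chart R carrier n);
  chart_at : carrier -> chart R carrier n;
  chart_at_atlas : forall y, atlas (chart_at y);
  dom_chart_at : forall y, dom (chart_at y) y;
  atlas_compatible : forall c c', atlas c -> atlas c' -> forall j : 'I_n,
    smooth_on (c @` (dom c `&` dom c')) (fun p => c' (cinv c p) 0 j) }.

Section Manifold.
Context {R : realType} {n : nat} (X : manifold R n).

Definition smooth (f : X -> R) : Prop :=
  forall c, atlas c -> smooth_on (c @` dom c) (f \o cinv c).

Record smooth_fun := SmoothFun {
  smooth_val :> X -> R;
  smooth_valP : smooth smooth_val }.

Definition compactly_supported (f : X -> R) : Prop :=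
  compact (closure [set y | f y != 0]).

Definition supnorm (U : set X) (h : X -> R) : \bar R :=
  ereal_sup [set `|h y|%:E | y in U].

(* Change of coordinates on tangent (row) vectors at [y], from [chart_at y]
   to [c]; recall that ['D_v f a = v *m 'J f a]. *)
Definition jac_to (c : chart R X n) (y : X) : 'M[R]_n :=
  'J (c \o cinv (chart_at y)) (chart_at y y).

Definition smooth_vector_field (v : X -> 'rV[R]_n) : Prop :=
  forall c, atlas c -> forall j : 'I_n,
    smooth_on (c @` dom c) (fun p => (v (cinv c p) *m jac_to c (cinv c p)) 0 j).

(* Smooth families of bilinear forms on the cotangent spaces. *)
Definition smooth_cotangent_form (b : X -> 'M[R]_n) : Prop :=
  forall c, atlas c -> forall i j : 'I_n,
    smooth_on (c @` dom c)
      (fun p => let J := jac_to c (cinv c p) in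
                (J^T *m b (cinv c p) *m J) i j).

Definition differential (f : X -> R) (y : X) : 'cV[R]_n :=
  \col_i partial i (f \o cinv (chart_at y)) (chart_at y y).

Definition diffop1 (lam : smooth_fun -> smooth_fun) : Prop :=
  exists2 v, smooth_vector_field v &
    forall f y, lam f y = (v y *m differential f y) 0 0.

Definition bidiffop1 (B : smooth_fun -> smooth_fun -> smooth_fun) : Prop :=
  exists2 b, smooth_cotangent_form b &
    forall f g y,
      B f g y = ((differential f y)^T *m b y *m differential g y) 0 0.

Definition antisymmetric_op (B : smooth_fun -> smooth_fun -> smooth_fun) :
    Prop :=
  forall f g y, B f g y = - B g f y.

(* At a critical point the invertibility of the Hessian matrix does not depend
   on the chart. *)
Definition hessian (f : X -> R) (y : X) : 'M[R]_n :=
  \matrix_(i, j) partial i (partial j (f \o cinv (chart_at y))) (chart_at y y).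

Definition nondegenerate_critical_point (f : X -> R) (y : X) : Prop :=
  differential f y = 0 /\ hessian f y \in unitmx.

End Manifold.

(* Main.v *)
From HB Require Import structures.
From mathcomp Require Import ring lra.
Require Import Defs.
Set Implicit Arguments.
Unset Strict Implicit.
Unset Printing Implicit Defensive.
Local Open Scope classical_set_scope.
Local Open Scope ring_scope.

(** Part (a) rests on a barrier argument in a chart around [x].  Write [u] for
    [lam f], [V] for the vector field, [v0] for its value at [x] and
    [a = - lam (lam (lam f)) x].  If [v0 = 0] then [lam F x = 0 = lam f x] for
    every [F].  Otherwise [- a] is the value at [v0] of the Hessian of [u] at
    [x] ([derive_field]), because [x] is critical for [u]; this Hessian is
    symmetric ([hess_sym]), negative semidefinite at a maximum ([hess_max]) and
    invertible, hence negative definite ([hess_neg]), and [a > 0].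

    Let [G = F - f], so that [|G| <= eps] on [U], and let [T] be the length
    scale given by [a * T ^ 3 = eps].  In a thin tube of half-length [T] around
    the line through [x] directed by [v0], maximise
      [G + beta * l - P / d ^ 2 * q]
    where [l] is a linear coordinate along [v0], [q] is the squared transverse
    distance and [d] is the radius of the tube.  With [beta] slightly above
    [eps / T] and [P = 3 * eps], the bound [|G| <= eps] forces the maximum away
    from the lateral boundary and from the entry face of the tube
    ([barrier_max]).  Moving backwards along [V] from the maximum point thus
    stays in the tube, which bounds [lam G] there from below by about
    [- eps / T = - a * T ^ 2] ([barrier_derive]), while the Taylor expansion of
    [u] gives [u >= u x - a * T ^ 2 / 2] up to a small multiple of [a * T ^ 2].
    Altogether [lam F = u + lam G >= lam f x - 8 / 5 * a * T ^ 2] at that point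
    ([quasi_max]), and [8 / 5 < (9 / 2) ^ (1 / 3)] while
    [a * T ^ 2 = a ^ (1 / 3) * eps ^ (2 / 3)] ([cube_root_bound]).  Comparing
    [F] with [f] through a maximum point rather than along an integral curve of
    [V] makes the proof independent of the flow of [V].

    Part (b) rests on composing one function [h] with two smooth staircases
    [s] and [s'] of the real line which are uniformly close to the identity and
    such that near every point one of the two is constant
    ([stair_or_stair'_flat]).  Then [s \o h] and [s' \o h] are uniformly close
    to [h], and at each point one of their differentials vanishes, so that [B]
    vanishes on them.  As [B] is not antisymmetric, its quadratic form is nonzero
    on some covector at some point ([nonisotropic_covector]), and [h] is a bump
    function with that differential, up to a factor, at that point ([bump]). *)

(** * Derivatives along lines and differentiability *)

Section Lines.
Context {R : realType} {V : normedModType R}.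
Implicit Types (f : V -> R) (q v : V).

Lemma is_derive_line f q v (s d : R) :
  is_derive (s *: v + q) v f d -> is_derive s 1 (fun t : R => f (t *: v + q)) d.
Proof.
have E : (fun h : R => h^-1 *: (((fun t : R => f (t *: v + q)) \o shift s) (h *: 1) -
    (fun t : R => f (t *: v + q)) s)) =
  (fun h : R => h^-1 *: ((f \o shift (s *: v + q)) (h *: v) - f (s *: v + q))).
  apply/funext => h /=; rewrite [h *: 1]mulr1 scalerDl addrA //.
by case=> fd <-; split; rewrite /derivable /derive E.
Qed.

(** Allowing [c] of either sign and bounding the intermediate parameter by
    [`|c|] spares a case split wherever a coordinate of an increment serves as
    [c]. *)
Lemma MVT_line f q v (c : R) :
  (forall s : R, `|s| <= `|c| -> derivable f (s *: v + q) v) ->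
  exists2 s : R, `|s| <= `|c| & f (c *: v + q) - f q = c * 'D_v f (s *: v + q).
Proof.
move=> fd; pose g (s : R) := f (s *: v + q).
have gd (s : R) : `|s| <= `|c| -> is_derive s 1 g ('D_v f (s *: v + q)).
  by move=> sc; apply: is_derive_line; apply: derivableP; exact: fd.
have gc (s : R) : `|s| <= `|c| -> {for s, continuous g}.
  move=> /gd [gs _]; apply: differentiable_continuous.
  exact/derivable1_diffP.
have -> : f q = g 0 by rewrite /g scale0r add0r.
rewrite -/(g c).
have [c0|c0] := leP 0 c.
  have [s||s] := @MVT_segment R g (fun s => 'D_v f (s *: v + q)) 0 c c0.
  - rewrite in_itv /= => /andP[s0 sc]; apply: gd.
    by rewrite !ger0_norm // ltW.
  - apply: continuous_in_subspaceT => s.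
    rewrite inE /= in_itv /= => /andP[s0 sc]; apply: gc.
    by rewrite !ger0_norm.
  rewrite in_itv /= => /andP[s0 sc] E; exists s; first by rewrite !ger0_norm.
  by rewrite E subr0 mulrC.
have [s||s] := @MVT_segment R g (fun s => 'D_v f (s *: v + q)) c 0 (ltW c0).
- rewrite in_itv /= => /andP[sc s0]; apply: gd.
  by rewrite !ltr0_norm // lerN2 ltW.
- apply: continuous_in_subspaceT => s.
  rewrite inE /= in_itv /= => /andP[sc s0]; apply: gc.
  by rewrite (ltr0_norm c0) ler0_norm // lerN2.
rewrite in_itv /= => /andP[sc s0] E; exists s.
  by rewrite (ltr0_norm c0) ler0_norm // lerN2.
by rewrite -opprB E sub0r mulrN opprK mulrC.
Qed.

End Lines.

Lemma continuous_sum (R : realType) (T : topologicalType) (m : nat)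
    (f : 'I_m -> T -> R) (x : T) :
  (forall i, {for x, continuous (f i)}) ->
  {for x, continuous (fun y => \sum_i f i y)}.
Proof.
move=> fc; have -> : (fun y => \sum_i f i y) = \sum_i f i.
  by apply/funext => y; rewrite fct_sumE.
elim/big_rec : _ => [|i g _ gc]; first exact: cst_continuous.
by apply: continuousD => //; exact: fc.
Qed.

Lemma differentiable_littleo (R : realType) (V W : normedModType R) (f : V -> W)
    (L : {linear V -> W}) (p : V) :
  continuous L ->
  (forall eps : R, 0 < eps -> \forall h \near (0 : V),
    `|f (h + p) - f p - L h| <= eps * `|h|) ->
  differentiable f p.
Proof.
move=> Lc fL; have E : f \o shift p = cst (f p) + L +o_ 0 id.
  apply/eqaddoP => _/posnumP[eps]; near=> h.
  rewrite !fctE /= opprD addrA.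
  by near: h; exact: fL.
by apply/diff_locallyP; rewrite (diff_unique Lc E).
Unshelve. all: by end_near. Qed.

Section Differentiable.
Context {R : realType} {n : nat}.
Implicit Types (f : 'rV[R]_n -> R) (p q h : 'rV[R]_n).
Local Notation e i := (delta_mx 0 i : 'rV[R]_n).

Lemma rV_norm_le h (r : R) :
  0 <= r -> (forall i, `|h 0 i| <= r) -> `|h| <= r.
Proof.
move=> r0 hr; rewrite [`|h|]mx_normrE; apply: bigmax_le => // -[i j] _ /=.
by rewrite (ord1 i).
Qed.

Lemma rV_coord_norm h i : `|h 0 i| <= `|h|.
Proof.
rewrite [leRHS]mx_normrE; exact: (le_bigmax _ (fun ij => `|h ij.1 ij.2|) (0, i)).
Qed.

(** The vertices of a path from [0] to [h] which moves along one coordinate axis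
    at a time. *)
Definition head_coords k h : 'rV[R]_n := \row_j (if (j < k)%N then h 0 j else 0).

Lemma head_coords0 h : head_coords 0 h = 0.
Proof. by apply/rowP => j; rewrite !mxE. Qed.

Lemma head_coords_full h : head_coords n h = h.
Proof. by apply/rowP => j; rewrite !mxE ltn_ord. Qed.

Lemma head_coordsS (k : 'I_n) h : head_coords k.+1 h = h 0 k *: e k + head_coords k h.
Proof.
apply/rowP => j; rewrite !mxE eqxx /= ltnS leq_eqVlt.
have [->|jk] := eqVneq j k; first by rewrite eqxx ltnn mulr1 addr0.
by rewrite mulr0 add0r; case: eqP => // /ord_inj /eqP; rewrite (negbTE jk).
Qed.

Definition linform (c : 'I_n -> R) h : R := \sum_i h 0 i * c i.

Lemma linform_is_linear c : linear (linform c).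
Proof.
move=> k u v; rewrite /linform scaler_sumr -big_split; apply: eq_bigr => i _ /=.
by rewrite !mxE mulrDl -mulrA.
Qed.

HB.instance Definition _ c :=
  GRing.isLinear.Build R 'rV[R]_n R _ (linform c) (linform_is_linear c).

Lemma linform_continuous c : continuous (linform c).
Proof.
move=> x; apply: continuous_sum => i.
apply: continuousM; last exact: cst_continuous.
exact: matrix_normedtype.coord_continuous.
Qed.

(** Going from [p] to [h + p] one coordinate at a time splits the increment of
    [f] into [n] increments along the axes.  The mean value theorem turns each
    into a coordinate of [h] times a partial derivative at a point no farther
    from [p] than [h + p], where continuity brings it close to its value at
    [p]. *)
Lemma partials_littleo f p :
  (\forall q \near p, forall i, derivable f q (e i)) ->
  (forall i, {for p, continuous (partial i f)}) ->
  forall eps : R, 0 < eps -> \forall h \near (0 : 'rV[R]_n),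
    `|f (h + p) - f p - linform (fun i => partial i f p) h| <= eps * `|h|.
Proof.
move=> fd fc eps eps0.
pose eps' := eps / (n.+1)%:R.
have eps'0 : 0 < eps' by rewrite divr_gt0.
have : \forall q \near p, (forall i, derivable f q (e i)) /\
    forall i, `|partial i f p - partial i f q| <= eps'.
  near=> q; split; first by near: q.
  near: q; apply: filter_forall => i.
  by have /cvgrPdist_le/(_ _ eps'0) := fc i.
move=> /nbhs_ballP [r /= r0 rP]; apply/nbhs_ballP; exists r => //= h.
rewrite -ball_normE /= sub0r normrN => hr.
have inball (k : 'I_n) (s : R) : `|s| <= `|h 0 k| ->
    ball p r (s *: e k + (head_coords k h + p)).
  move=> sh; rewrite -ball_normE /= addrA opprD addrCA subrr addr0 normrN.
  apply: le_lt_trans hr; apply: rV_norm_le => // j.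
  rewrite !mxE eqxx /=; have [->|jk] := eqVneq j k.
    by rewrite ltnn mulr1 addr0 (le_trans sh)// rV_coord_norm.
  rewrite mulr0 add0r; case: ifP => _; first exact: rV_coord_norm.
  by rewrite normr0.
have -> : f (h + p) - f p =
    \sum_(k < n) (f (head_coords k.+1 h + p) - f (head_coords k h + p)).
  rewrite -(big_mkord xpredT (fun k => f (head_coords k.+1 h + p) - f (head_coords k h + p))).
  by rewrite telescope_sumr // head_coords_full head_coords0 add0r.
rewrite /linform -sumrB (le_trans (ler_norm_sum _ _ _)) //.
apply: (@le_trans _ _ (\sum_(k < n) eps' * `|h|)); last first.
  rewrite sumr_const card_ord -[leLHS]mulr_natr mulrAC ler_wpM2r //.
  by rewrite -mulrA ler_piMr ?(ltW eps0)// mulrC ler_pdivrMr// mul1r ler_nat.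
apply: ler_sum => k _; rewrite head_coordsS -[_ + p in X in X - _]addrA.
have [s sh ->] : exists2 s : R, `|s| <= `|h 0 k| &
    f (h 0 k *: e k + (head_coords k h + p)) - f (head_coords k h + p) =
    h 0 k * 'D_(e k) f (s *: e k + (head_coords k h + p)).
  apply: MVT_line => s sh; by have [] := rP _ (inball k s sh).
rewrite -mulrBr normrM mulrC ler_pM // ?rV_coord_norm // distrC.
by have [_] := rP _ (inball k s sh); exact.
Unshelve. all: by end_near. Qed.

Lemma differentiable_partials f p :
  (\forall q \near p, forall i, derivable f q (e i)) ->
  (forall i, {for p, continuous (partial i f)}) ->
  differentiable f p.
Proof.
move=> fd fc.
exact: (differentiable_littleo (@linform_continuous _) (partials_littleo fd fc)).
Qed.

Lemma derive_partials f p v : differentiable f p ->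
  'D_v f p = linform (fun i => partial i f p) v.
Proof.
move=> fd; rewrite deriveE // [v in LHS](row_sum_delta v) linear_sum.
by apply: eq_bigr => i _; rewrite linearZ /partial deriveE.
Qed.

End Differentiable.

Lemma differentiable_rV (R : realType) (n : nat) (V : normedModType R)
    (Phi : V -> 'rV[R]_n) (q : V) :
  (forall j, differentiable (fun p => Phi p 0 j) q) -> differentiable Phi q.
Proof.
move=> H; have -> : Phi = \sum_(j < n) (fun p => Phi p 0 j *: (delta_mx 0 j : 'rV[R]_n)).
  by apply/funext => p; rewrite fct_sumE [LHS]row_sum_delta.
by apply: differentiable_sum => j; apply: differentiableZl.
Qed.

(** * Functions of class C^k on open sets *)

(** Derivability of [f] in the single direction [v] is enough, as only the
    restriction of [f] to a line is composed with [phi]. *)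
Lemma is_derive_comp1 (R : realType) (V : normedModType R) (f : V -> R)
    (phi : R -> R) (x v : V) (df dphi : R) :
  is_derive x v f df -> is_derive (f x) 1 phi dphi ->
  is_derive x v (phi \o f) (dphi * df).
Proof.
move=> fd phid.
have gd : is_derive (0 : R) 1 (fun t : R => f (t *: v + x)) df.
  by apply: is_derive_line; rewrite scale0r add0r.
have E : (fun t : R => f (t *: v + x)) 0 = f x by rewrite scale0r add0r.
rewrite -E in phid.
have [H1 H2] := is_derive1_comp phid gd.
split; first exact/derivable1P.
rewrite -H2 /derive; do 2 f_equal; apply/funext => h /=.
by rewrite scale0r add0r addr0 [h *: 1]mulr1.
Qed.

Lemma near_eq_continuous (T U : topologicalType) (f g : T -> U) (x : T) :
  {near x, f =1 g} -> {for x, continuous f} -> {for x, continuous g}.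
Proof.
move=> fg fc; rewrite /prop_for /continuous_at -(nbhs_singleton fg).
by apply: cvg_trans fc; apply: near_eq_cvg; apply: filterS fg => y ->.
Qed.

Section Ck.
Context {R : realType} {n : nat}.
Implicit Types (A B : set 'rV[R]_n) (f g : 'rV[R]_n -> R) (p : 'rV[R]_n).
Local Notation e i := (delta_mx 0 i : 'rV[R]_n).

Lemma Ck_continuous k A f p : Ck k A f -> A p -> {for p, continuous f}.
Proof. by case: k => [|k] [fc _] Ap; apply: fc; rewrite inE. Qed.

Lemma Ck_derivable k A f p i : Ck k.+1 A f -> A p -> derivable f p (e i).
Proof. by move=> [_ /(_ i)[fd _]] Ap; apply: fd; rewrite inE. Qed.

Lemma Ck_partial k A f i : Ck k.+1 A f -> Ck k A (partial i f).
Proof. by move=> [_ /(_ i)[]]. Qed.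

Lemma Ck_S k A f :
  (forall p, A p -> {for p, continuous f}) ->
  (forall p i, A p -> derivable f p (e i)) ->
  (forall i, Ck k A (partial i f)) -> Ck k.+1 A f.
Proof.
move=> fc fd fk; split=> [p|i]; first by rewrite inE; exact: fc.
by split=> // p; rewrite inE; exact: fd.
Qed.

Lemma Ck_pred k A f : Ck k.+1 A f -> Ck k A f.
Proof.
elim: k f => [|k IH] f fk; first by split => // p; rewrite inE; exact: Ck_continuous fk.
apply: Ck_S => [p|p i|i].
- exact: Ck_continuous fk.
- exact: Ck_derivable fk.
- by apply/IH/Ck_partial.
Qed.

(** [Ck] is a pointwise condition on iterated partial derivatives, so it can be
    checked on neighborhoods; this is how functions given by different formulas
    in different regions (staircases, bump functions) are shown smooth. *)
Lemma Ck_local k A f :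
  (forall p, A p -> exists B, B p /\ Ck k B f) -> Ck k A f.
Proof.
elim: k f => [|k IH] f fk.
  by split => // p; rewrite inE => /fk [B [Bp /Ck_continuous]]; exact.
apply: Ck_S => [p|p i|i].
- by move=> /fk [B [Bp /Ck_continuous]]; exact.
- by move=> /fk [B [Bp /Ck_derivable]]; exact.
- by apply: IH => p /fk [B [Bp /Ck_partial Bf]]; exists B.
Qed.

Lemma Ck_subset k A B f : B `<=` A -> Ck k A f -> Ck k B f.
Proof. by move=> BA fk; apply: Ck_local => p /BA Ap; exists A. Qed.

(** Openness of [A] makes the two functions equal near each of its points, so
    that their partial derivatives agree on [A] too. *)
Lemma Ck_eq k A f g : open A -> {in A, f =1 g} -> Ck k A f -> Ck k A g.
Proof.
move=> Ao; have near_fg f' g' p : {in A, f' =1 g'} -> A p -> {near p, f' =1 g'}.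
  move=> fg Ap; near=> q; apply: fg; rewrite inE; near: q.
  exact: open_nbhs_nbhs.
elim: k f g => [|k IH] f g fg fk.
  by split=> // p; rewrite inE => Ap; apply: near_eq_continuous (near_fg _ _ _ fg Ap) _; exact: Ck_continuous fk Ap.
apply: Ck_S => [p Ap|p i Ap|i].
- apply: near_eq_continuous (near_fg _ _ _ fg Ap) _; exact: Ck_continuous fk Ap.
- exact: near_eq_derivable (near_fg _ _ _ fg Ap) (Ck_derivable fk Ap).
- apply: (IH (partial i f)); last exact: Ck_partial.
  by move=> p; rewrite inE => Ap; rewrite /partial; exact: near_eq_derive (near_fg _ _ _ fg Ap).
Unshelve. all: by end_near. Qed.

Lemma Ck_cst k A (a : R) : Ck k A (cst a).
Proof.
elim: k a => [|k IH] a; first by split => // p _; exact: cst_continuous.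
apply: Ck_S => [p _|p i _|i]; first exact: cst_continuous.
  exact: derivable_cst.
have -> : partial i (cst a) = cst 0 by apply/funext => p; exact: derive_cst.
exact: IH.
Qed.

Lemma Ck_add k A f g : open A -> Ck k A f -> Ck k A g -> Ck k A (f \+ g).
Proof.
move=> Ao; elim: k f g => [|k IH] f g fk gk.
  split => // p; rewrite inE => Ap.
  by apply: continuousD; [exact: Ck_continuous fk Ap|exact: Ck_continuous gk Ap].
apply: Ck_S => [p Ap|p i Ap|i].
- by apply: continuousD; [exact: Ck_continuous fk Ap|exact: Ck_continuous gk Ap].
- by apply: derivableD; [exact: Ck_derivable fk Ap|exact: Ck_derivable gk Ap].
apply: (Ck_eq Ao) (IH _ _ (Ck_partial i fk) (Ck_partial i gk)) => p.
rewrite inE => Ap; rewrite /partial /= deriveD //.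
- exact: Ck_derivable fk Ap.
- exact: Ck_derivable gk Ap.
Qed.

Lemma Ck_mul k A f g : open A -> Ck k A f -> Ck k A g -> Ck k A (f \* g).
Proof.
move=> Ao; elim: k f g => [|k IH] f g fk gk.
  split => // p; rewrite inE => Ap.
  by apply: continuousM; [exact: Ck_continuous fk Ap|exact: Ck_continuous gk Ap].
apply: Ck_S => [p Ap|p i Ap|i].
- by apply: continuousM; [exact: Ck_continuous fk Ap|exact: Ck_continuous gk Ap].
- by apply: derivableM; [exact: Ck_derivable fk Ap|exact: Ck_derivable gk Ap].
have fgk := IH _ _ (Ck_pred fk) (Ck_partial i gk).
have gfk := IH _ _ (Ck_pred gk) (Ck_partial i fk).
apply: (Ck_eq Ao) (Ck_add Ao fgk gfk) => p.
rewrite inE => Ap; rewrite /partial /= deriveM //.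
- exact: Ck_derivable fk Ap.
- exact: Ck_derivable gk Ap.
Qed.

Lemma Ck_sum k A (m : nat) (F : 'I_m -> 'rV[R]_n -> R) : open A ->
  (forall i, Ck k A (F i)) -> Ck k A (fun p => \sum_i F i p).
Proof.
move=> Ao Fk; have -> : (fun p => \sum_i F i p) = \sum_i F i.
  by apply/funext => p; rewrite fct_sumE.
by elim/big_rec : _ => [|i g _ gc]; [exact: Ck_cst|exact: Ck_add].
Qed.

(** Smoothness of a function of one variable, witnessed by the sequence of its
    derivatives: the induction in [Ck_comp] trades one order of differentiation
    for a shift of the index [j]. *)
Definition derivatives_on (D : set R) (phi : nat -> R -> R) :=
  forall j s, D s -> is_derive s 1 (phi j) (phi j.+1 s).

Lemma Ck_comp k A f (D : set R) phi j : open A -> derivatives_on D phi ->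
  (forall p, A p -> D (f p)) -> Ck k A f -> Ck k A (phi j \o f).
Proof.
move=> Ao phid fD; elim: k j => [|k IH] j fk.
  split => // p; rewrite inE => Ap.
  apply: continuous_comp; first exact: Ck_continuous fk Ap.
  have [d _] := phid j _ (fD _ Ap).
  exact/differentiable_continuous/derivable1_diffP.
have phif p i : A p ->
    is_derive p (e i) (phi j \o f) (phi j.+1 (f p) * partial i f p).
  move=> Ap; apply: is_derive_comp1; last exact/phid/fD.
  exact/derivableP/(Ck_derivable fk).
apply: Ck_S => [p Ap|p i Ap|i].
  apply: continuous_comp; first exact: Ck_continuous fk Ap.
  have [d _] := phid j _ (fD _ Ap).
  exact/differentiable_continuous/derivable1_diffP.
  by have [] := phif p i Ap.
apply: (Ck_eq Ao) (Ck_mul Ao (IH j.+1 (Ck_pred fk)) (Ck_partial i fk)) => p.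
by rewrite inE => Ap; rewrite /partial; have [_ ->] := phif p i Ap.
Qed.

Lemma Ck_differentiable k A f p : open A -> Ck k.+1 A f -> A p ->
  differentiable f p.
Proof.
move=> Ao fk Ap; apply: differentiable_partials.
  near=> q => i; apply: (Ck_derivable fk).
  by near: q; apply: open_nbhs_nbhs.
by move=> i; exact: Ck_continuous (Ck_partial i fk) Ap.
Unshelve. all: by end_near. Qed.

End Ck.

Section CkAffine.
Context {R : realType} {n : nat}.
Implicit Types (A : set 'rV[R]_n) (f : 'rV[R]_n -> R) (p : 'rV[R]_n).

Lemma Ck_scale k A (a : R) f : open A -> Ck k A f -> Ck k A (fun p => a * f p).
Proof. by move=> Ao fk; apply: (Ck_mul Ao (Ck_cst k A a)). Qed.

Lemma Ck_shift k A (a : R) f : open A -> Ck k A f -> Ck k A (fun p => a + f p).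
Proof. by move=> Ao fk; apply: (Ck_add Ao (Ck_cst k A a)). Qed.

Lemma Ck_shiftN k A (a : R) f : open A -> Ck k A f -> Ck k A (fun p => a - f p).
Proof.
move=> Ao fk; apply: (Ck_eq Ao) (Ck_shift a Ao (Ck_scale (-1) Ao fk)) => p _ /=.
by rewrite mulN1r.
Qed.

End CkAffine.

(** * Linear forms and sums of squares *)

Section SumSquares.
Context {R : realType} {n : nat}.
Implicit Types (p q : 'rV[R]_n).

Definition sumsq p : R := \sum_j p 0 j ^+ 2.

Lemma sumsq0 : sumsq 0 = 0.
Proof. by rewrite /sumsq big1 // => j _; rewrite mxE expr0n. Qed.

Lemma sumsq_norm p (r : R) : 0 <= r -> sumsq p <= r ^+ 2 -> `|p| <= r.
Proof.
move=> r0 pr; apply: rV_norm_le => // i.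
rewrite -(@ler_pXn2r _ 2) ?nnegrE // real_normK ?num_real //.
apply: le_trans pr; rewrite /sumsq (bigD1 i) //= lerDl.
by apply: sumr_ge0 => j _; exact: sqr_ge0.
Qed.

Lemma is_derive_linform (xi : 'I_n -> R) p v :
  is_derive p v (linform xi) (linform xi v).
Proof.
have E : {near (0 : R)^', cst (linform xi v) =1
    (fun h => h^-1 *: ((linform xi \o shift p) (h *: v) - linform xi p))}.
  near=> h; rewrite /= linearP addrK [RHS]mulrA mulVf ?mul1r //.
  by near: h; exact: nbhs_dnbhs_neq.
have L : (h^-1 *: ((linform xi \o shift p) (h *: v) - linform xi p)) @[h --> (0 : R)^'] -->
    linform xi v.
  exact: cvg_trans (near_eq_cvg E) (cvg_cst _).
by split; [apply/cvg_ex; exists (linform xi v)|exact: (cvg_lim _ L)].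
Unshelve. all: by end_near. Qed.

Lemma Ck_linform k (A : set 'rV[R]_n) xi : Ck k A (linform xi).
Proof.
have C0 p : {for p, continuous (linform xi)} by exact: linform_continuous.
case: k => [|k]; first by split => // p _; exact: C0.
apply: Ck_S => [p _|p i _|i]; first exact: C0.
  by have [] := is_derive_linform xi p (delta_mx 0 i).
rewrite (_ : partial i _ = cst (linform xi (delta_mx 0 i))); first exact: Ck_cst.
by apply/funext => p; rewrite /partial; have [_ ->] := is_derive_linform xi p (delta_mx 0 i).
Qed.

Lemma linform_delta (xi : 'I_n -> R) i : linform xi (delta_mx 0 i) = xi i.
Proof.
rewrite /linform (bigD1 i) //= mxE !eqxx mul1r big1 ?addr0 // => j ji.
by rewrite mxE eqxx (negbTE ji) mul0r.
Qed.

Lemma linform_coord j p : linform (fun i => (i == j)%:R) p = p 0 j.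
Proof.
rewrite /linform (bigD1 j) //= eqxx mulr1 big1 ?addr0 // => i.
by move=> /negbTE ->; rewrite mulr0.
Qed.

Lemma Ck_coord k (A : set 'rV[R]_n) j : Ck k A (fun p => p 0 j).
Proof.
rewrite (_ : (fun p => _) = linform (fun i => (i == j)%:R)); first exact: Ck_linform.
by apply/funext => p; rewrite linform_coord.
Qed.

Lemma sumsq_continuous p0 : continuous (fun p => sumsq (p - p0)).
Proof.
move=> p; apply: continuous_sum => j.
have c : {for p, continuous (fun p : 'rV[R]_n => (p - p0) 0 j)}.
  rewrite (_ : (fun p => _) = (fun p => p 0 j - p0 0 j)).
    apply: continuousB; last exact: cst_continuous.
    exact: matrix_normedtype.coord_continuous.
  by apply/funext => q; rewrite !mxE.
exact: (continuousM c c).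
Qed.

Lemma sumsq_ball_compact p0 (r : R) : compact [set p | sumsq (p - p0) <= r ^+ 2].
Proof.
apply: bounded_closed_compact.
  exists (`|r| + `|p0|); split; first exact: num_real.
  move=> M HM p /= pr; apply: le_trans (ltW HM).
  rewrite -[p](subrK p0) (le_trans (ler_normD _ _)) // lerD2r.
  by apply: sumsq_norm => //; rewrite real_normK ?num_real.
rewrite (_ : [set _ | _] = (fun p => sumsq (p - p0)) @^-1` [set t | t <= r ^+ 2]) //.
by apply: closed_comp => [p _|]; [exact: sumsq_continuous|exact: closed_le].
Qed.

End SumSquares.

(** * The Hessian at a critical point *)

Section SecondOrder.
Context {R : realType} {n : nat}.
Implicit Types (f : 'rV[R]_n -> R) (p q h x y : 'rV[R]_n) (A : set 'rV[R]_n).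
Local Notation e i := (delta_mx 0 i : 'rV[R]_n).

Definition bil (H : 'M[R]_n) x y : R := (x *m H *m y^T) 0 0.

Lemma bilE H x y : bil H x y = \sum_j (\sum_i x 0 i * H i j) * y 0 j.
Proof. by rewrite /bil mxE; apply: eq_bigr => j _; rewrite !mxE. Qed.

Lemma bilDl H x x' y : bil H (x + x') y = bil H x y + bil H x' y.
Proof. by rewrite /bil !mulmxDl mxE. Qed.

Lemma bilDr H x y y' : bil H x (y + y') = bil H x y + bil H x y'.
Proof. by rewrite /bil [(y + y')^T]linearD /= mulmxDr mxE. Qed.

Lemma bilZl H x y (a : R) : bil H (a *: x) y = a * bil H x y.
Proof. by rewrite /bil -!scalemxAl mxE. Qed.

Lemma bilZr H x y (a : R) : bil H x (a *: y) = a * bil H x y.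
Proof. by rewrite /bil [(a *: y)^T]linearZ /= -scalemxAr mxE. Qed.

Lemma bil_bound H : exists2 M : R, 0 <= M & forall x y, `|bil H x y| <= M * `|x| * `|y|.
Proof.
exists (\sum_j \sum_i `|H i j|); first by do 2 (apply: sumr_ge0 => ? _).
move=> x y; rewrite bilE (le_trans (ler_norm_sum _ _ _)) // !mulr_suml.
apply: ler_sum => j _; rewrite normrM ler_pM ?rV_coord_norm //.
rewrite (le_trans (ler_norm_sum _ _ _)) // mulr_suml; apply: ler_sum => i _.
by rewrite normrM mulrC ler_wpM2l // rV_coord_norm.
Qed.

(** Indexed so that [hessian f y] is [hess] of the expression of [f] in the
    preferred chart at [y]. *)
Definition hess f p : 'M[R]_n := \matrix_(i, j) partial i (partial j f) p.

Lemma Ck_littleo A f p : open A -> Ck 1 A f -> A p ->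
  forall eps : R, 0 < eps -> \forall h \near (0 : 'rV[R]_n),
    `|f (h + p) - f p - linform (fun i => partial i f p) h| <= eps * `|h|.
Proof.
move=> Ao fk Ap; apply: partials_littleo.
  near=> q => i; apply: (Ck_derivable fk).
  by near: q; exact: open_nbhs_nbhs.
by move=> i; exact: Ck_continuous (Ck_partial i fk) Ap.
Unshelve. all: by end_near. Qed.

Lemma near0_ball (P : 'rV[R]_n -> Prop) : (\forall h \near (0 : 'rV[R]_n), P h) ->
  exists2 r : R, 0 < r & forall h, `|h| < r -> P h.
Proof.
move=> /nbhs_ballP [r /= r0 rP]; exists r => // h hr; apply: rP.
by rewrite -ball_normE /= sub0r normrN.
Qed.

(** First-order expansion at [p] of all the partial derivatives at once: the
    common source of the Taylor formula and of the symmetry of the Hessian. *)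
Lemma Ck2_expansion A f p (eps : R) : open A -> Ck 2 A f -> A p -> 0 < eps ->
  exists2 r : R, 0 < r & forall h, `|h| < r -> A (h + p) /\
    forall j, `|partial j f (h + p) - partial j f p - \sum_i h 0 i * hess f p i j|
              <= eps * `|h|.
Proof.
move=> Ao fk Ap eps0; apply: near0_ball; near=> h; split.
  near: h; have : \forall q \near p, A q by exact: open_nbhs_nbhs.
  by rewrite (near_shift 0) /= subr0.
near: h; apply: filter_forall => j.
have := Ck_littleo Ao (Ck_partial j fk) Ap eps0.
apply: filterS => h; rewrite /linform.
by under [X in _ -> `|_ - X| <= _]eq_bigr do rewrite mxE.
Unshelve. all: by end_near. Qed.

(** The mean value theorem is applied to
    [t |-> f (t *: h + p) - t ^ 2 / 2 * bil H h h], whose derivative is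
    [o(|h| ^ 2)] on the unit interval since the gradient of [f] at [t *: h + p]
    is [t * H h + o(|h|)]. *)
Lemma taylor2 A f p (eps : R) : open A -> Ck 2 A f -> A p -> 0 < eps ->
  (forall j, partial j f p = 0) ->
  exists2 r : R, 0 < r & forall h, `|h| < r -> A (h + p) /\
    `|f (h + p) - f p - 1/2 * bil (hess f p) h h| <= eps * `|h| ^+ 2.
Proof.
move=> Ao fk Ap eps0 df0.
have eps'0 : 0 < eps / n.+1%:R by rewrite divr_gt0.
have [r r0 rP] := Ck2_expansion Ao fk Ap eps'0.
exists r => // h hr; split; first by have [] := rP h hr.
have shr (s : R) : `|s| <= 1 -> `|s *: h| < r.
  by move=> s1; apply: le_lt_trans hr; rewrite normrZ ler_piMl.
pose Q := bil (hess f p) h h.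
pose g (t : R) := f (t *: h + p) - 1/2 * Q * t ^+ 2.
have gd (s : R) : `|s| <= 1 ->
    is_derive s 1 g (linform (fun j => partial j f (s *: h + p)) h - Q * s).
  move=> s1; have [Ash _] := rP _ (shr s s1).
  have fd : differentiable f (s *: h + p) by exact: (Ck_differentiable Ao fk Ash).
  have L : is_derive s 1 (fun t : R => f (t *: h + p))
      (linform (fun j => partial j f (s *: h + p)) h).
    rewrite -derive_partials //; apply: is_derive_line.
    exact/derivableP/diff_derivable.
  rewrite /g; apply: is_derive_eq; rewrite /GRing.scale /=; by field.
have [c||c] := @MVT_segment R g (fun s => linform (fun j => partial j f (s *: h + p)) h - Q * s) 0 1 ler01.
- by rewrite in_itv /= => /andP[c0 c1]; apply: gd; rewrite ger0_norm ?ltW.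
- apply: continuous_in_subspaceT => s; rewrite inE /= in_itv /= => /andP[s0 s1].
  have s1' : `|s| <= 1 by rewrite ger0_norm.
  have [d _] := gd s s1'.
  exact/differentiable_continuous/derivable1_diffP.
rewrite in_itv /= => /andP[c0 c1]; rewrite /g scale1r expr1n mulr1 scale0r add0r.
rewrite expr0n mulr0 !subr0 mulr1 => E.
rewrite [X in `|X|](_ : _ = linform (fun j => partial j f (c *: h + p)) h - Q * c); last first.
  by rewrite -E /Q; ring.
rewrite /Q bilE /linform mulr_suml -sumrB (le_trans (ler_norm_sum _ _ _)) //.
apply: (@le_trans _ _ (\sum_(j < n) eps / n.+1%:R * `|h| ^+ 2)); last first.
  rewrite sumr_const card_ord -[leLHS]mulr_natr mulrAC ler_wpM2r ?sqr_ge0 //.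
  by rewrite -mulrA ler_piMr ?(ltW eps0)// mulrC ler_pdivrMr// mul1r ler_nat.
apply: ler_sum => j _.
have c1' : `|c| <= 1 by rewrite ger0_norm.
have [_ /(_ j)] := rP _ (shr c c1'); rewrite df0 subr0 => Hj.
have -> : h 0 j * partial j f (c *: h + p) - (\sum_i h 0 i * hess f p i j) * h 0 j * c =
  h 0 j * (partial j f (c *: h + p) - \sum_i (c *: h) 0 i * hess f p i j).
  have -> : \sum_i (c *: h) 0 i * hess f p i j = c * \sum_i h 0 i * hess f p i j.
    by rewrite mulr_sumr; apply: eq_bigr => i _; rewrite !mxE mulrA.
  by ring.
rewrite normrM expr2 mulrA mulrC ler_pM ?rV_coord_norm //.
apply: (le_trans Hj); rewrite ler_wpM2l ?(ltW eps'0) // normrZ ler_piMl //.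
Qed.

Lemma is_derive_translate f x v (w : 'rV[R]_n) (d : R) :
  is_derive (x + w) v f d -> is_derive x v (fun q => f (q + w)) d.
Proof.
have E : (fun h : R => h^-1 *: (((fun q => f (q + w)) \o shift x) (h *: v) - f (x + w))) =
  (fun h : R => h^-1 *: ((f \o shift (x + w)) (h *: v) - f (x + w))).
  by apply/funext => h /=; rewrite addrA.
by case=> fd <-; split; rewrite /derivable /derive E.
Qed.

(** The mean value theorem in the direction [e i], for
    [q |-> f (q + s *: e j) - f q], leaves a difference of two values of
    [partial i f], which the expansion at [p] evaluates. *)
Lemma second_difference A f p (eps : R) i j : open A -> Ck 2 A f -> A p -> 0 < eps ->
  exists2 r : R, 0 < r & forall s : R, 0 < s < r ->
   `|f (s *: e i + s *: e j + p) - f (s *: e i + p) - f (s *: e j + p) + f p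
     - s ^+ 2 * hess f p j i| <= eps * s ^+ 2.
Proof.
move=> Ao fk Ap eps0; have eps'0 : 0 < eps / 3 by rewrite divr_gt0.
have [r r0 rP] := Ck2_expansion Ao fk Ap eps'0.
exists (r / 2) => [|s /andP[s0 sr]]; first by rewrite divr_gt0.
have sr2 : 2 * s < r by lra.
have sr1 : s < r by lra.
have e1 k : `|e k| <= 1.
  apply: rV_norm_le => // l; rewrite mxE eqxx /=.
  by case: eqP => _; rewrite ?normr1 ?normr0.
have n1 (t : R) k : `|t| <= s -> `|t *: e k| <= s.
  by move=> ts; rewrite normrZ -[leRHS]mulr1 ler_pM.
have n2 (t : R) : `|t| <= s -> `|t *: e i + s *: e j| <= 2 * s.
  move=> ts; rewrite (le_trans (ler_normD _ _)) // mulr_natl mulr2n lerD ?n1 //.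
  by rewrite gtr0_norm.
pose phi q := f (q + s *: e j) - f q.
have phid (t : R) : `|t| <= s -> is_derive (t *: e i + p) (e i) phi
    (partial i f (t *: e i + p + s *: e j) - partial i f (t *: e i + p)).
  move=> ts; have [A1 _] := rP (t *: e i + s *: e j) (le_lt_trans (n2 t ts) sr2).
  have [A2 _] := rP (t *: e i) (le_lt_trans (n1 t i ts) sr1).
  apply: is_deriveB; last exact/derivableP/(Ck_derivable fk).
  apply/is_derive_translate/derivableP/(Ck_derivable fk).
  by rewrite -addrA [p + _]addrC addrA.
have [t] : exists2 t : R, `|t| <= `|s| &
    phi (s *: e i + p) - phi p = s * 'D_(e i) phi (t *: e i + p).
  by apply: MVT_line => t; rewrite (gtr0_norm s0) => /phid[].
rewrite (gtr0_norm s0) => ts; have [_ ->] := phid t ts.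
rewrite /phi => E.
have [_ /(_ i) H1] := rP (t *: e i + s *: e j) (le_lt_trans (n2 t ts) sr2).
have [_ /(_ i) H2] := rP (t *: e i) (le_lt_trans (n1 t i ts) sr1).
have E1 : \sum_k (t *: e i + s *: e j) 0 k * hess f p k i =
    \sum_k (t *: e i) 0 k * hess f p k i + s * hess f p j i.
  have -> : s * hess f p j i = \sum_k (s *: e j) 0 k * hess f p k i.
    rewrite (bigD1 j) //= !mxE !eqxx mulr1 big1 ?addr0 // => k kj.
    by rewrite !mxE eqxx (negbTE kj) mulr0 mul0r.
  rewrite -big_split; apply: eq_bigr => k _ /=.
  by rewrite !mxE mulrDl.
have EA : t *: e i + p + s *: e j = t *: e i + s *: e j + p.
  by rewrite -addrA [p + _]addrC addrA.
move: E H1 H2; rewrite EA E1.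
set P1 := partial i f _; set P2 := partial i f _; set P0 := partial i f p.
set S := \sum_k _; set Hji := hess f p j i => E H1 H2.
have {}E : f (s *: e i + s *: e j + p) - f (s *: e i + p) - f (s *: e j + p) + f p =
    s * (P1 - P2).
  rewrite -E -[s *: e i + s *: e j + p]addrA [s *: e j + p]addrC addrA; ring.
rewrite E [X in `|X|](_ : _ = s * ((P1 - P0 - (S + s * Hji)) - (P2 - P0 - S))); last by ring.
rewrite normrM (gtr0_norm s0) expr2 mulrCA ler_wpM2l ?(ltW s0) //.
rewrite (le_trans (ler_normB _ _)) //.
have H1' := le_trans H1 (ler_wpM2l (ltW eps'0) (n2 t ts)).
have H2' := le_trans H2 (ler_wpM2l (ltW eps'0) (n1 t i ts)).
apply: (le_trans (lerD H1' H2')); lra.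
Qed.

(** The second difference is symmetric in [i] and [j], hence so is its
    limit after division by [s ^ 2]. *)
Lemma hess_sym A f p : open A -> Ck 2 A f -> A p -> (hess f p)^T = hess f p.
Proof.
move=> Ao fk Ap; apply/matrixP => i j; rewrite mxE; apply/eqP.
rewrite -subr_eq0 -normr_le0; apply/ler_addgt0Pl => eps eps0; rewrite addr0.
have eps'0 : 0 < eps / 2 by rewrite divr_gt0.
have [r1 r10 H1] := second_difference i j Ao fk Ap eps'0.
have [r2 r20 H2] := second_difference j i Ao fk Ap eps'0.
pose s := Num.min r1 r2 / 2.
have m0 : 0 < Num.min r1 r2 by rewrite lt_min r10.
have s0 : 0 < s by rewrite divr_gt0.
have sm : s < Num.min r1 r2 by rewrite /s ltr_pdivrMr // ltr_pMr // ltr1n.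
move: sm; rewrite lt_min => /andP[s1 s2].
have s20 : 0 < s ^+ 2 by rewrite exprn_gt0.
have := H1 s; rewrite s0 s1 => /(_ isT) {}H1.
have := H2 s; rewrite s0 s2 [s *: e j + _]addrC => /(_ isT) {}H2.
rewrite -(ler_pM2r s20) -{1}(gtr0_norm s20) -normrM mulrBl.
move: H1 H2; rewrite !ler_norml.
set a := f _; set b := f _; set c := f _; set d := f _.
rewrite ![_ * s ^+ 2]mulrC.
set x := s ^+ 2 * hess f p j i; set y := s ^+ 2 * hess f p i j.
have -> : s ^+ 2 * eps = 2 * (s ^+ 2 * (eps / 2)) by field.
by move=> /andP[? ?] /andP[? ?]; apply/andP; split; lra.
Qed.

(** If the form were positive at [h], the Taylor formula would make [f] exceed
    [f p] at [p + t *: h] for small [t]. *)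
Lemma hess_max A f p : open A -> Ck 2 A f -> A p -> (forall q, A q -> f q <= f p) ->
  (forall j, partial j f p = 0) -> forall h, bil (hess f p) h h <= 0.
Proof.
move=> Ao fk Ap fmax df0 h; rewrite leNgt; apply/negP => Q0.
set Q := bil _ _ _ in Q0; pose m := `|h| ^+ 2 + 1.
have m0 : 0 < m by rewrite ltr_wpDl // sqr_ge0.
have eps0 : 0 < Q / (4 * m) by rewrite divr_gt0 // mulr_gt0.
have [r r0 rP] := taylor2 Ao fk Ap eps0 df0.
pose t := r / (2 * (`|h| + 1)).
have h1 : 0 < `|h| + 1 by rewrite ltr_wpDl.
have t0 : 0 < t by rewrite divr_gt0 // mulr_gt0.
have tr : `|t *: h| < r.
  rewrite normrZ (gtr0_norm t0) /t mulrAC ltr_pdivrMr ?mulr_gt0 //.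
  by rewrite ltr_pM2l //; have := normr_ge0 h; lra.
have [/fmax fle] := rP _ tr.
rewrite bilZl bilZr -/Q normrZ (gtr0_norm t0) exprMn ler_norml => /andP[H _].
have t20 : 0 < t ^+ 2 by rewrite exprn_gt0.
(* The Taylor error is at most half of the quadratic term. *)
have : Q / (4 * m) * (t ^+ 2 * `|h| ^+ 2) <= t ^+ 2 * Q / 4.
  have -> : Q / (4 * m) * (t ^+ 2 * `|h| ^+ 2) = t ^+ 2 * Q / 4 * (`|h| ^+ 2 / m).
    by field; rewrite gt_eqF.
  rewrite ler_piMr //; first by rewrite divr_ge0 // mulr_ge0 ?ltW.
  by rewrite ler_pdivrMr // mul1r lerDl.
have : 0 < t ^+ 2 * Q by rewrite mulr_gt0.
have -> : t ^+ 2 * Q = t * (t * Q) by rewrite mulrA -expr2.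
lra.
Qed.

Lemma bil_sym H x y : H^T = H -> bil H x y = bil H y x.
Proof.
move=> HT; have trE (M : 'M[R]_1) : M^T 0 0 = M 0 0 by rewrite mxE.
by rewrite /bil -trE !trmx_mul trmxK HT mulmxA.
Qed.

(** For a semidefinite form, an isotropic vector [v] lies in the kernel: the
    value at [v + s *: w] is [2 s B + s ^ 2 C] with [B = bil H v w], which has
    constant sign only if [B = 0]. *)
Lemma hess_neg A f p : open A -> Ck 2 A f -> A p -> (forall q, A q -> f q <= f p) ->
  (forall j, partial j f p = 0) -> hess f p \in unitmx ->
  forall v, v != 0 -> bil (hess f p) v v < 0.
Proof.
move=> Ao fk Ap fmax df0 HU v v0.
have Hle := hess_max Ao fk Ap fmax df0; have Hsym := hess_sym Ao fk Ap.
set H := hess f p in Hle Hsym HU *.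
rewrite lt_neqAle Hle andbT; apply: contra_neq v0 => Qv.
suff Hv w : bil H v w = 0.
  apply: (can_inj (mulmxK HU)); rewrite mul0mx; apply/rowP => j.
  have := Hv (delta_mx 0 j); rewrite /bil trmx_delta -colE !mxE => E.
  by rewrite -[RHS]E.
have Hw (s : R) : 2 * s * bil H v w + s ^+ 2 * bil H w w <= 0.
  have := Hle (v + s *: w); rewrite bilDl !bilDr !bilZr !bilZl Qv (bil_sym w v Hsym).
  by rewrite add0r; set B := bil H v w; set C := bil H w w; lra.
set B := bil H v w in Hw *; set C := bil H w w in Hw.
have C0 : C <= 0 by exact: Hle.
have [//|B0] := eqVneq B 0.
(* [1 - C > 0] keeps the denominator away from 0 when [C = 0]. *)
pose s := B / (1 - C).
have D0 : 0 < 1 - C by lra.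
have := Hw s.
have -> : 2 * s * B + s ^+ 2 * C = (B ^+ 2 / (1 - C)) * (1 + 1 / (1 - C)).
  by rewrite /s; field; rewrite gt_eqF.
have B2 : 0 < B ^+ 2 by rewrite exprn_even_gt0.
rewrite leNgt => /negP; case; apply: mulr_gt0; first exact: divr_gt0.
by apply: addr_gt0 => //; exact: divr_gt0.
Qed.

End SecondOrder.

(** * Flat functions and smooth staircases *)

Section Flat.
Context {R : realType}.
Implicit Types (P : {poly R}) (s x : R).

Lemma exprn_le_expR k x : 0 <= x -> x ^+ k <= k`!%:R * expR x.
Proof.
case: k => [|k] x0.
  by rewrite expr0 fact0 mul1r (le_trans _ (expR_ge1Dx x)) // lerDl.
rewrite mulrC -ler_pdivrMr ?ltr0n ?fact_gt0 //.
by rewrite (le_trans _ (expR_ge1Dxn k x0)) // lerDr.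
Qed.

Lemma horner_le_expR P : exists2 C : R, 0 <= C & forall x, 0 <= x -> `|P.[x]| <= C * expR x.
Proof.
exists (\sum_(i < size P) `|P`_i| * i`!%:R).
  by apply: sumr_ge0 => i _; rewrite mulr_ge0.
move=> x x0; rewrite horner_coef (le_trans (ler_norm_sum _ _ _)) // mulr_suml.
apply: ler_sum => i _; rewrite normrM -mulrA ler_wpM2l //.
by rewrite ger0_norm ?exprn_ge0 // exprn_le_expR.
Qed.

(** These functions form a family closed under differentiation: since
    [d(1/s) = - s^-2], the derivative of the one attached to [P] is the one
    attached to ['X^2 * (P - P^`())]. *)
Definition flat_exp P s : R := if 0 < s then P.[s^-1] * expR (- s^-1) else 0.

(** A bound by [C * s ^ 2] yields derivative [0] at the origin, the only point
    where differentiability is not obvious. *)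
Lemma flat_exp_le P : exists2 C : R, 0 <= C & forall s, `|flat_exp P s| <= C * s ^+ 2.
Proof.
have [C C0 HC] := horner_le_expR (P * 'X^2).
exists C => // s; rewrite /flat_exp; case: ifP => s0; last first.
  by rewrite normr0 mulr_ge0 // sqr_ge0.
have := HC s^-1; rewrite invr_ge0 ltW // => /(_ isT).
rewrite hornerM hornerXn normrM normrX normrM (ger0_norm (expR_ge0 _)) expRN.
rewrite normfV (gtr0_norm s0) exprVn => H.
by rewrite ler_pdivrMr ?expR_gt0 // mulrAC -ler_pdivrMr // exprn_gt0.
Qed.

Lemma is_derive_flat_exp P s :
  is_derive s 1 (flat_exp P) (flat_exp ('X^2 * (P - P^`())) s).
Proof.
have [s0|s0|<-] := ltgtP 0 s.
- have nf : {near s, (fun x => P.[x^-1] * expR (- x^-1)) =1 flat_exp P}.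
    near=> x; rewrite /flat_exp ifT //; near: x; exact: lt_nbhsr.
  apply: (near_eq_is_derive nf); rewrite /flat_exp s0.
  have sn0 : s != 0 by rewrite gt_eqF.
  have dP : is_derive s^-1 1 (horner P) P^`().[s^-1].
    split; first exact: derivable_horner.
    by rewrite -derive1E -derivE.
  have dV : is_derive s 1 (fun x : R => x^-1) (- s^-2 *: 1).
    exact: (is_deriveV (f := id) sn0).
  have dE : is_derive s 1 (expR \o (fun x : R => - x^-1)) (expR (- s^-1) * - (- s^-2 *: 1)).
    exact: is_derive1_comp.
  have dPV := is_derive1_comp dP dV.
  apply: (is_derive_eq (is_deriveM dPV dE)).
  rewrite /= !hornerE /GRing.scale /= !mulr1.
  rewrite -exprVn. ring.
- have nf : {near s, (cst 0) =1 flat_exp P}.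
    near=> x; rewrite /flat_exp ifF //; apply/negbTE; rewrite -leNgt ltW//.
    near: x; exact: lt_nbhsl.
  apply: (near_eq_is_derive nf); rewrite /flat_exp ifF.
    exact: is_derive_cst.
  by apply/negbTE; rewrite -leNgt ltW.
- rewrite {2}/flat_exp ltxx.
  have [C C0 HC] := flat_exp_le P.
  have H : (fun h : R => h^-1 *: ((flat_exp P \o shift 0) (h *: 1) - flat_exp P 0)) @ 0^' --> (0:R).
    apply/cvgrPdist_le => eps eps0; near=> h.
    rewrite /= addr0 [h *: 1]mulr1 {2}/flat_exp ltxx subr0 sub0r normrN.
    have h0 : h != 0 by near: h; exact: nbhs_dnbhs_neq.
    rewrite normrM normfV mulrC ler_pdivrMr ?normr_gt0 //.
    rewrite (le_trans (HC h)) // -real_normK ?num_real // expr2 mulrA.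
    rewrite ler_wpM2r //; apply: (@le_trans _ _ (C * (eps / (C + 1)))).
      rewrite ler_wpM2l //; near: h; apply: dnbhs0_le.
      by rewrite divr_gt0 // ltr_wpDl.
    by rewrite mulrA ler_pdivrMr ?ltr_wpDl // mulrC ler_wpM2l ?(ltW eps0) // lerDl.
  by split; [apply/cvg_ex; exists 0|exact: cvg_lim H].
Unshelve. all: by end_near. Qed.

(** [expinv] is [exp (- 1 / s)] extended by [0] to [s <= 0], and [expinv_deriv j]
    is its [j]-th derivative. *)
Definition expinv_deriv (j : nat) : R -> R :=
  flat_exp (iter j (fun P => 'X^2 * (P - P^`())) 1).
Definition expinv : R -> R := expinv_deriv 0.

Lemma expinv_derivatives : derivatives_on setT expinv_deriv.
Proof. by move=> j s _; exact: is_derive_flat_exp. Qed.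

Lemma expinvE s : expinv s = if 0 < s then expR (- s^-1) else 0.
Proof. by rewrite /expinv /expinv_deriv /flat_exp /= hornerC mul1r. Qed.

Lemma expinv_le0 s : s <= 0 -> expinv s = 0.
Proof. by rewrite expinvE leNgt => /negbTE ->. Qed.

Lemma expinv_gt0 s : 0 < s -> 0 < expinv s.
Proof. by move=> s0; rewrite expinvE s0 expR_gt0. Qed.

Lemma expinv_ge0 s : 0 <= expinv s.
Proof. by rewrite expinvE; case: ifP => // _; exact: expR_ge0. Qed.

Lemma expinv_nondecreasing s t : s <= t -> expinv s <= expinv t.
Proof.
move=> st; rewrite !expinvE; case: ifP => s0; last by case: ifP => // _; exact: expR_ge0.
by rewrite (lt_le_trans s0 st) ler_expR lerN2 lef_pV2 ?posrE ?(lt_le_trans s0 st).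
Qed.

(** The inner term exceeds [1] for [s <= 1/8], where the outer [expinv] then
    vanishes, and is [0] for [3/8 <= s].  Nesting [expinv] instead of
    normalising it by a quotient leaves composition as the only operation to
    control. *)
Definition step s : R := (expinv 1)^-1 * expinv (1 - (expinv (1/4))^-1 * expinv (3/8 - s)).

Lemma step0 s : s <= 1/8 -> step s = 0.
Proof.
move=> s8; rewrite /step (expinv_le0 (s := 1 - _)) ?mulr0 //.
have e0 : 0 < expinv (1/4) by apply: expinv_gt0; lra.
rewrite subr_le0 mulrC ler_pdivlMr // !mul1r; apply: expinv_nondecreasing; lra.
Qed.

Lemma step1 s : 3/8 <= s -> step s = 1.
Proof.
move=> s8; rewrite /step (expinv_le0 (s := 3/8 - s)); last by lra.
by rewrite mulr0 subr0 mulVf // gt_eqF // expinv_gt0.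
Qed.

Lemma step_ge0 s : 0 <= step s.
Proof. by rewrite mulr_ge0 ?invr_ge0 ?expinv_ge0. Qed.

Lemma step_le1 s : step s <= 1.
Proof.
rewrite /step mulrC ler_pdivrMr ?expinv_gt0 // !mul1r expinv_nondecreasing //.
by rewrite gerBl mulr_ge0 ?invr_ge0 ?expinv_ge0.
Qed.

(** Constant outside the intervals [[k + 1/8, k + 3/8]]; its translate [stair']
    moves only on [[k + 5/8, k + 7/8]].  The gaps of positive length between
    the two families of intervals give local constancy of one of the two
    functions at each point, end points included. *)
Definition stair s : R := (Num.floor s)%:~R + step (s - (Num.floor s)%:~R).

(** A formula valid on an interval around the integer [k], where [stair] is not
    given by a single value of the floor. *)
Lemma stair_local (k : int) s :
  k%:~R - 1/2 < s < k%:~R + 1 -> stair s = k%:~R + step (s - k%:~R).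
Proof.
move=> /andP[ks sk]; rewrite /stair; have [ks0|sk0] := leP k%:~R s.
  by rewrite (@floor_def _ _ k) // ks0 intrD /= sk.
have -> : Num.floor s = k - 1.
  apply: floor_def; rewrite subrK sk0 andbT intrB; lra.
rewrite intrB step1; last by lra.
by rewrite step0; lra.
Qed.

Lemma stair_dist s : `|stair s - s| <= 1.
Proof.
rewrite /stair ler_norml; have /andP[] := floor_itv s; rewrite intrD.
have := step_ge0 (s - (Num.floor s)%:~R); have := step_le1 (s - (Num.floor s)%:~R).
by move=> *; apply/andP; split; lra.
Qed.

Lemma stair_const (k : int) s :
  k%:~R - 1/2 < s -> s < k%:~R + 1/8 -> stair s = k%:~R.
Proof.
move=> ks sk; rewrite (stair_local (k := k)); last by rewrite ks /=; lra.
by rewrite step0; lra.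
Qed.

Lemma stair0 : stair 0 = 0.
Proof. by rewrite /stair floor0 subr0 step0 ?addr0 //; lra. Qed.

Definition stair' s : R := stair (s + 1/2) - 1.

Lemma stair'0 : stair' 0 = 0.
Proof. by rewrite /stair' (stair_local (k := 0)) ?step1 ; lra. Qed.

Lemma stair'_dist s : `|stair' s - s| <= 2.
Proof.
have := stair_dist (s + 1/2); rewrite /stair' !ler_norml => /andP[? ?].
by apply/andP; split; lra.
Qed.

Lemma stair_or_stair'_flat s :
  (\forall t \near s, stair t = stair s) \/ (\forall t \near s, stair' t = stair' s).
Proof.
have /andP[] := floor_itv s; rewrite intrD; set k := Num.floor s => s0 s1.
have flat l : l%:~R - 1/2 < s -> s < l%:~R + 1/8 ->
    \forall t \near s, stair t = stair s.
  move=> ls sl; near=> t; rewrite !(stair_const (k := l)) //.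
  - by near: t; exact: lt_nbhsr.
  - by near: t; exact: lt_nbhsl.
have [s8|s8] := ltP s (k%:~R + 1/8); first by left; apply: (flat k); lra.
have [s2|s2] := ltP (k%:~R + 1/2) s.
  by left; apply: (flat (k + 1)); rewrite intrD; lra.
right; near=> t; rewrite /stair' !(stair_const (k := k + 1)) // intrD.
- by lra.
- by lra.
- suff : k%:~R < t by lra.
  by near: t; apply: lt_nbhsr; lra.
- suff : t < k%:~R + 5/8 by lra.
  by near: t; apply: lt_nbhsl; lra.
Unshelve. all: by end_near. Qed.

End Flat.

Section CkStair.
Context {R : realType} {n : nat}.
Implicit Types (A : set 'rV[R]_n) (f : 'rV[R]_n -> R) (p : 'rV[R]_n).

Lemma Ck_expinv k A f : open A -> Ck k A f -> Ck k A (fun p => expinv (f p)).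
Proof. by move=> Ao; apply: (Ck_comp 0 Ao expinv_derivatives). Qed.

Lemma Ck_step k A f : open A -> Ck k A f -> Ck k A (fun p => step (f p)).
Proof.
move=> Ao fk; rewrite /step; apply: Ck_scale => //.
by apply/Ck_expinv/Ck_shiftN/Ck_scale/Ck_expinv/Ck_shiftN.
Qed.

Lemma Ck_stair k A f : open A -> Ck k A f -> Ck k A (fun p => stair (f p)).
Proof.
move=> Ao fk; apply: Ck_local => p Ap.
pose l := Num.floor (f p); have /andP[lf fl] := floor_itv (f p).
have near_l : nbhs p [set q | A q /\ l%:~R - 1/2 < f q < l%:~R + 1].
  have fc := Ck_continuous fk Ap.
  have l1 : l%:~R - 1/2 < f p by rewrite /l; lra.
  have l2 : f p < l%:~R + 1 by rewrite /l -[1]/(1%:~R) -intrD.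
  have lo := fc _ (lt_nbhsr l1); have hi := fc _ (lt_nbhsl l2).
  near=> q; split; first by near: q; exact: open_nbhs_nbhs.
  by apply/andP; split; near: q; [exact: lo|exact: hi].
move: near_l; rewrite nbhsE => -[B [Bo Bp] BA]; exists B; split => //.
have Bk : Ck k B f by apply: Ck_subset fk => q /BA [].
apply: (Ck_eq Bo) (Ck_shift l%:~R Bo (Ck_step Bo (Ck_shift (- l%:~R) Bo Bk))) => q.
by rewrite inE => /BA [_ /stair_local ->]; rewrite [_ + f q]addrC.
Unshelve. all: by end_near. Qed.

End CkStair.

(** * Charts and the chain rule *)

Lemma near_continuous (T U : topologicalType) (g : T -> U) (x : T) (P : set U) :
  {for x, continuous g} -> (\forall s \near g x, P s) -> \forall t \near x, P (g t).
Proof. by move=> gc; exact: gc. Qed.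

Section Charts.
Context {R : realType} {n : nat} (X : manifold R n).
Implicit Types (c : chart R X n).

Lemma cinv_dom c p : (c @` dom c) p -> dom c (cinv c p) /\ c (cinv c p) = p.
Proof. by move=> [y yc <-]; rewrite (coordK (c:=c)) ?inE. Qed.

Lemma cinv_in_dom c c' p : (c @` dom c) p -> dom c' (cinv c p) ->
  nbhs p [set q | (c @` dom c) q /\ dom c' (cinv c q)].
Proof.
move=> cp c'p.
have H1 : nbhs p (c @` dom c) by apply: open_nbhs_nbhs; split => //; exact: open_coord.
have H2 : nbhs p [set q | dom c' (cinv c q)].
  apply: (near_continuous (g := cinv c) (P := dom c')).
    by apply: cinv_continuous; rewrite inE.
  by apply: open_nbhs_nbhs; split => //; exact: open_dom.
by apply: filterI.
Qed.

Lemma open_overlap c c' : open (c @` (dom c `&` dom c')).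
Proof.
rewrite openE => _ [y [yc yc'] <-].
have : nbhs (c y) [set q | (c @` dom c) q /\ dom c' (cinv c q)].
  by apply: cinv_in_dom; [exists y|rewrite coordK ?inE].
apply: filterS => q [/cinv_dom[qc E] qc'].
by exists (cinv c q).
Qed.

End Charts.

Section ChainRule.
Context {R : realType} {n : nat} (X : manifold R n).
Implicit Types (f g h : smooth_fun X) (c : chart R X n).

Lemma smooth_Ck f c k : atlas c -> Ck k (c @` dom c) (f \o cinv c).
Proof. by move=> cA; exact: (smooth_valP f cA k). Qed.

Lemma smooth_differentiable f c y : atlas c -> dom c y ->
  differentiable (f \o cinv c) (c y).
Proof.
move=> cA yc; have co := @open_coord _ _ _ c.
by apply: (Ck_differentiable co (smooth_Ck f 1 cA)); exists y.
Qed.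

(** The chain rule for [cinv (chart_at y)] factored through the chart [c]; by it
    a vector field acts as one directional derivative in a fixed chart. *)
Lemma vector_derive f c y (w : 'rV[R]_n) : atlas c -> dom c y ->
  (w *m differential f y) 0 0 = 'D_(w *m jac_to c y) (f \o cinv c) (c y).
Proof.
move=> cA yc; set c' := chart_at y.
have c'A : atlas c' by exact: chart_at_atlas.
have yc' : dom c' y by exact: dom_chart_at.
have oo := @open_overlap _ _ X c' c.
have yO : (c' @` (dom c' `&` dom c)) (c' y) by exists y.
pose Phi := c \o cinv c'.
have Phiy : Phi (c' y) = c y by rewrite /Phi /= coordK ?inE.
have dPhi : differentiable Phi (c' y).
  apply: differentiable_rV => j.
  have Pk : Ck 1 (c' @` (dom c' `&` dom c)) (fun p => c (cinv c' p) 0 j).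
    exact: atlas_compatible.
  exact: (Ck_differentiable oo Pk yO).
have dF := smooth_differentiable f cA yc; rewrite -Phiy in dF.
have -> : (w *m differential f y) 0 0 = 'D_w (f \o cinv c') (c' y).
  rewrite derive_partials; last exact: smooth_differentiable.
  by rewrite mxE; apply: eq_bigr => i _; rewrite !mxE.
have nE : {near c' y, f \o cinv c' =1 (f \o cinv c) \o Phi}.
  have : nbhs (c' y) (c' @` (dom c' `&` dom c)) by exact: open_nbhs_nbhs.
  apply: filterS => _ [z [zc' zc] <-] /=.
  by rewrite /Phi /= [cinv c' _]coordK ?inE // coordK ?inE.
rewrite (near_eq_derive w nE) deriveE; last exact: differentiable_comp.
rewrite diff_comp //= -Phiy deriveE // -[in RHS]deriveEjacobian // [in RHS]deriveE //.
Qed.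

Lemma diffop1_chart (lam : smooth_fun X -> smooth_fun X) (v : X -> 'rV[R]_n) c p f :
  (forall f y, lam f y = (v y *m differential f y) 0 0) ->
  atlas c -> (c @` dom c) p ->
  lam f (cinv c p) =
  'D_(v (cinv c p) *m jac_to c (cinv c p)) (f \o cinv c) p.
Proof. by move=> lamE cA /cinv_dom[pc E]; rewrite lamE (vector_derive _ _ cA pc) E. Qed.

End ChainRule.

(** * Bump functions with a prescribed differential *)

Section Bump.
Context {R : realType} {n : nat} (X : manifold R n).

(** A linear form in the coordinates cut off by [expinv]: at [y0] the linear
    form vanishes, so that the differential there is [xi] times the value of
    the cut-off. *)
Definition bump c (y0 : X) (r : R) (xi : 'I_n -> R) (z : X) : R :=
  if `[< dom c z >] then expinv (r ^+ 2 - sumsq (c z - c y0)) * linform xi (c z - c y0)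
  else 0.

Context (c : chart R X n) (cA : atlas c) (y0 : X) (r : R) (xi : 'I_n -> R).
Context (ballA : forall p, sumsq (p - c y0) <= r ^+ 2 -> (c @` dom c) p).
Let K := cinv c @` [set p | sumsq (p - c y0) <= r ^+ 2].

Lemma bump_support_compact : compact K.
Proof.
apply: continuous_compact; last exact: sumsq_ball_compact.
apply: continuous_in_subspaceT => p; rewrite inE /= => /ballA cp.
by apply: cinv_continuous; rewrite inE.
Qed.

Lemma bump_support_closed : closed K.
Proof. by apply: compact_closed; [exact: carrier_hausdorff|exact: bump_support_compact]. Qed.

Lemma bump_support z : bump c y0 r xi z != 0 -> K z.
Proof.
rewrite /bump; case: asboolP => [zc|_]; last by rewrite eqxx.
have [zr _|zr] := leP (sumsq (c z - c y0)) (r ^+ 2).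
  by exists (c z) => //; rewrite coordK ?inE.
by rewrite expinv_le0 ?mul0r ?eqxx // subr_le0 ltW.
Qed.

Lemma bump_compactly_supported : compactly_supported (bump c y0 r xi).
Proof.
apply: subclosed_compact bump_support_compact _; first exact: closed_closure.
rewrite [X in _ `<=` X](closure_id K).1; last exact: bump_support_closed.
by apply: closure_subset => z /bump_support.
Qed.

Lemma Ck_bump_formula k (A : set 'rV[R]_n) (F : 'I_n -> 'rV[R]_n -> R) : open A ->
  (forall j, Ck k A (F j)) ->
  Ck k A (fun p => expinv (r ^+ 2 - \sum_j (F j p - c y0 0 j) ^+ 2) *
                   \sum_j (F j p - c y0 0 j) * xi j).
Proof.
move=> Ao FA; have FB j : Ck k A (fun p => F j p - c y0 0 j).
  by apply: (Ck_add Ao) => //; exact: Ck_cst.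
apply: (Ck_mul Ao).
  apply/Ck_expinv/Ck_shiftN => //; apply: Ck_sum => // j.
  exact: (Ck_mul Ao (FB j) (FB j)).
by apply: Ck_sum => // j; apply: (Ck_mul Ao) => //; exact: Ck_cst.
Qed.

Lemma bumpE z : dom c z -> bump c y0 r xi z =
  expinv (r ^+ 2 - \sum_j (c z 0 j - c y0 0 j) ^+ 2) *
  \sum_j (c z 0 j - c y0 0 j) * xi j.
Proof.
move=> zc; rewrite /bump asboolT // /sumsq /linform; congr (expinv (_ - _) * _);
  by apply: eq_bigr => j _; rewrite !mxE.
Qed.

(** Near a point of [dom c] the defining formula is smooth in the coordinates.
    A point outside [dom c] has a neighborhood avoiding the compact set [K],
    which is closed because [X] is Hausdorff. *)
Lemma smooth_bump : smooth (bump c y0 r xi).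
Proof.
move=> c' c'A k; apply: Ck_local => _ [y yc' <-].
have [yc|yc] := asboolP (dom c y).
  exists (c' @` (dom c' `&` dom c)); split; first by exists y.
  have oo := @open_overlap _ _ X c' c.
  have F j : Ck k (c' @` (dom c' `&` dom c)) (fun p => c (cinv c' p) 0 j).
    exact: atlas_compatible.
  apply: (Ck_eq oo) (Ck_bump_formula oo F) => p.
  by rewrite inE => -[z [zc' zc] <-] /=; rewrite coordK ?inE // bumpE.
have Ky : ~ K y.
  by move=> [p /= /ballA [z zc <-]]; rewrite coordK ?inE // => zy; rewrite zy in zc.
have : nbhs (c' y) [set q | (c' @` dom c') q /\ ~ K (cinv c' q)].
  have H1 : nbhs (c' y) (c' @` dom c').
    by apply: open_nbhs_nbhs; split; [exact: open_coord|exists y].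
  have H2 : nbhs (c' y) [set q | ~ K (cinv c' q)].
    apply: (near_continuous (g := cinv c') (P := ~` K)).
      by apply: cinv_continuous; rewrite inE; exists y.
    apply: open_nbhs_nbhs; split; first exact/closed_openC/bump_support_closed.
    by rewrite coordK ?inE.
  by apply: filterI.
rewrite nbhsE => -[B [Bo By] BK]; exists B; split => //.
apply: (Ck_eq Bo) (Ck_cst _ _ 0) => p; rewrite inE => /BK [_ pK] /=.
by case: (eqVneq (bump c y0 r xi (cinv c' p)) 0) => // /bump_support.
Qed.

End Bump.

(** * Approximation by functions with disjointly supported differentials *)

Section Stairs.
Context {R : realType} {n : nat} (X : manifold R n).
Implicit Types (f g h : smooth_fun X).

Definition stairN (N : nat) (s : R) := N.+1%:R^-1 * stair (N.+1%:R * s).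
Definition stairN' (N : nat) (s : R) := N.+1%:R^-1 * stair' (N.+1%:R * s).

Lemma smooth_stairN N h : smooth (stairN N \o h).
Proof.
move=> c cA k; rewrite /stairN /comp; have co := @open_coord _ _ _ c.
by apply/Ck_scale/Ck_stair/Ck_scale => //; exact: smooth_valP.
Qed.

Lemma smooth_stairN' N h : smooth (stairN' N \o h).
Proof.
move=> c cA k; rewrite /stairN' /stair' /comp; have co := @open_coord _ _ _ c.
apply: Ck_scale => //; rewrite (_ : (fun _ => _) =
  fun p => -1 + stair (1/2 + N.+1%:R * h (cinv c p))); last first.
  by apply/funext => p; rewrite addrC [1/2 + _]addrC.
by apply/Ck_shift/Ck_stair/Ck_shift/Ck_scale => //; exact: smooth_valP.
Qed.

Definition stair_fun N h : smooth_fun X := SmoothFun (smooth_stairN N h).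
Definition stair'_fun N h : smooth_fun X := SmoothFun (smooth_stairN' N h).

Lemma near_const_differential f y (a : R) :
  (\forall p \near chart_at y y, f (cinv (chart_at y) p) = a) ->
  differential f y = 0.
Proof.
move=> fa; apply/colP => i; rewrite !mxE /partial.
by rewrite (near_eq_derive (g := cst a)) ?derive_cst.
Qed.

Lemma smooth_continuous h y :
  {for chart_at y y, continuous (h \o cinv (chart_at y))}.
Proof.
have hk : Ck 0 (chart_at y @` dom (chart_at y)) (h \o cinv (chart_at y)).
  exact: (smooth_valP h (chart_at_atlas y) 0%N).
apply: (Ck_continuous hk).
by exists y => //; exact: dom_chart_at.
Qed.

Lemma scaled_dist (m s t d : R) : 0 < m -> `|t - m * s| <= d ->
  `|m^-1 * t - s| <= d / m.
Proof.
move=> m0 H; have -> : m^-1 * t - s = (t - m * s) / m.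
  by rewrite mulrBl [m * s]mulrC mulfK ?gt_eqF // mulrC.
by rewrite normrM normfV (gtr0_norm m0) ler_pM2r ?invr_gt0.
Qed.

(** Local constancy of a staircase near [h y] passes to its composition with
    [h] near [y]. *)
Lemma stair_flat_or N h y :
  differential (stair_fun N h) y = 0 \/ differential (stair'_fun N h) y = 0.
Proof.
have hc := @smooth_continuous h y.
set s := N.+1%:R * h (cinv (chart_at y) (chart_at y y)).
have gc : {for chart_at y y, continuous (fun p => N.+1%:R * h (cinv (chart_at y) p))}.
  by apply: continuousM; [exact: cst_continuous|exact: hc].
have [H|H] := stair_or_stair'_flat s; [left|right].
- apply: (@near_const_differential _ _ (stairN N (h (cinv (chart_at y) (chart_at y y))))) => /=.
  rewrite /stairN; apply: (near_continuous (P := fun t => _ * stair t = _) gc).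
  by apply: filterS H => t ->.
- apply: (@near_const_differential _ _ (stairN' N (h (cinv (chart_at y) (chart_at y y))))) => /=.
  rewrite /stairN'; apply: (near_continuous (P := fun t => _ * stair' t = _) gc).
  by apply: filterS H => t ->.
Qed.

(** The point [y0] excludes the empty space, where the supremum norm is
    [-oo]. *)
Lemma supnorm_cvg0 (u : nat -> X -> R) (y0 : X) (C : R) :
  (forall k y, `|u k y| <= C / k.+1%:R) ->
  supnorm setT (u k) @[k --> \oo] --> 0%E.
Proof.
move=> uC.
apply: (@squeeze_cvge _ _ _ _ (cst 0%E) _ (fun k => (C / k.+1%:R)%:E)).
- near=> k; apply/andP; split.
    apply: (@le_trans _ _ `|u k y0|%:E); first by rewrite lee_fin.
    by apply: ereal_sup_ubound; exists y0.
  by apply: ge_ereal_sup => _ [y _ <-]; rewrite lee_fin.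
- exact: cvg_cst.
- apply: cvg_EFin; first by near=> k.
  rewrite -[X in _ --> X](mulr0 C); apply: cvgM; first exact: cvg_cst.
  exact: cvg_harmonic.
Unshelve. all: by end_near. Qed.

Lemma compactly_supported_comp (phi : R -> R) h :
  phi 0 = 0 -> compactly_supported h -> compactly_supported (phi \o h).
Proof.
move=> phi0; rewrite /compactly_supported => hK.
apply: subclosed_compact hK _; first exact: closed_closure.
by apply: closure_subset => y /=; apply: contra => /eqP ->; rewrite phi0.
Qed.

End Stairs.

Section PartB.
Context {R : realType} {n : nat} (X : manifold R n).
Implicit Types (f g h : smooth_fun X).

Lemma bump_differential (y0 : X) (r : R) (xi : 'I_n -> R) :
  differential (bump (chart_at y0) y0 r xi) y0 = expinv (r ^+ 2) *: \col_i xi i.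
Proof.
set c := chart_at y0; set p0 := c y0.
have p0A : (c @` dom c) p0 by exists y0 => //; exact: dom_chart_at.
have Ao := @open_coord _ _ _ c.
pose E (p : 'rV[R]_n) := expinv (r ^+ 2 - \sum_j (p 0 j - p0 0 j) ^+ 2).
pose L (p : 'rV[R]_n) := \sum_j (p 0 j - p0 0 j) * xi j.
have Ek : Ck 1 setT E.
  apply: (Ck_expinv openT); apply: (Ck_shiftN _ openT); apply: (Ck_sum openT) => j.
  have Fj : Ck 1 setT (fun p : 'rV[R]_n => p 0 j - p0 0 j).
    by apply: (Ck_add openT) => //; [exact: Ck_coord|exact: Ck_cst].
  exact: (Ck_mul openT Fj Fj).
have LE : L = linform xi \- cst (linform xi p0).
  apply/funext => p; rewrite /= -linearB /linform; apply: eq_bigr => j _.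
  by rewrite !mxE.
apply/colP => i; rewrite !mxE /partial.
have near_eq : {near p0, (fun p => E p * L p) =1 bump c y0 r xi \o cinv c}.
  have : nbhs p0 (c @` dom c) by exact: open_nbhs_nbhs.
  apply: filterS => p /cinv_dom[pc Ep] /=.
  by rewrite bumpE // Ep.
rewrite -(near_eq_derive _ near_eq).
have dE : derivable E p0 (delta_mx 0 i) by apply: (Ck_derivable Ek).
have dL : is_derive p0 (delta_mx 0 i) L (xi i).
  rewrite LE -[xi i]subr0 -(linform_delta xi i).
  exact: (is_deriveB (is_derive_linform _ _ _) (is_derive_cst _ _ _)).
have [dL1 dL2] := dL.
have L0 : L p0 = 0 by rewrite LE /= subrr.
have E0 : E p0 = expinv (r ^+ 2).
  by rewrite /E big1 ?subr0 // => j _; rewrite subrr expr0n.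
have := deriveM dE dL1; rewrite dL2 L0 E0 scale0r addr0 => ->.
by [].
Qed.

(** By polarisation, a bilinear form vanishing on the diagonal is
    antisymmetric. *)
Lemma nonisotropic_covector (B : smooth_fun X -> smooth_fun X -> smooth_fun X)
    (b : X -> 'M[R]_n) :
  (forall f g y, B f g y = ((differential f y)^T *m b y *m differential g y) 0 0) ->
  ~ antisymmetric_op B ->
  exists (y : X) (xi : 'cV[R]_n), (xi^T *m b y *m xi) 0 0 != 0.
Proof.
move=> BE; apply: contra_notP => Hn f g y; rewrite !BE.
set u := differential f y; set v := differential g y.
have H (xi : 'cV[R]_n) : (xi^T *m b y *m xi) 0 0 = 0.
  by apply/eqP/negP => /negP Hxi; apply: Hn; exists y, xi.
have := H (u + v); rewrite [(u + v)^T]linearD /= !mulmxDl !mulmxDr.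
have addE (M N : 'M[R]_1) : (M + N) 0 0 = M 0 0 + N 0 0 by rewrite mxE.
rewrite !addE (H u) (H v) addr0 add0r => /eqP.
by rewrite addr_eq0 => /eqP.
Qed.

(** Uniform closeness of the staircases to the identity ([stair_dist],
    [stair'_dist]) gives the two limits, and [stair_flat_or] the vanishing. *)
Lemma bilinear_approximation (B : smooth_fun X -> smooth_fun X -> smooth_fun X) :
    bidiffop1 B ->
    ~ antisymmetric_op B ->
    exists (h : smooth_fun X) (f_ g_ : nat -> smooth_fun X),
      [/\ compactly_supported h,
          forall k, compactly_supported (f_ k) /\ compactly_supported (g_ k),
          supnorm setT (fun y => f_ k y - h y) @[k --> \oo] --> 0%E /\
          supnorm setT (fun y => g_ k y - h y) @[k --> \oo] --> 0%E,
          exists y : X, B h h y != 0 &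
          forall (k : nat) (y : X), B (f_ k) (g_ k) y = 0].
Proof.
move=> [b _ BE] nB; have [y0 [xi xi0]] := nonisotropic_covector BE nB.
set c := chart_at y0.
have : nbhs (c y0) (c @` dom c).
  apply: open_nbhs_nbhs; split; first exact: open_coord.
  by exists y0 => //; exact: dom_chart_at.
move=> /nbhs_ballP [d /= d0 dA].
have d2 : 0 < d / 2 by rewrite divr_gt0.
have ballA p : sumsq (p - c y0) <= (d / 2) ^+ 2 -> (c @` dom c) p.
  move=> /(sumsq_norm (ltW d2)) pd; apply: dA.
  by rewrite -ball_normE /= distrC (le_lt_trans pd) // ltr_pdivrMr // ltr_pMr // ltr1n.
pose h := SmoothFun (@smooth_bump _ _ _ c (chart_at_atlas y0) y0 (d / 2) (fun i => xi i 0) ballA).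
have hK : compactly_supported h by exact: bump_compactly_supported.
exists h, (fun N => stair_fun N h), (fun N => stair'_fun N h); split => //.
- move=> N; split; apply: compactly_supported_comp => //.
    by rewrite /stairN mulr0 stair0 mulr0.
  by rewrite /stairN' mulr0 stair'0 mulr0.
- split; [apply: (@supnorm_cvg0 _ _ _ _ y0 1)|apply: (@supnorm_cvg0 _ _ _ _ y0 2)] => N y.
    by apply: scaled_dist => //; exact: stair_dist.
  by apply: scaled_dist => //; exact: stair'_dist.
- exists y0; rewrite BE (bump_differential y0 (d / 2)).
  rewrite (_ : \col_i xi i 0 = xi); last by apply/colP => i; rewrite mxE.
  rewrite [(_ *: xi)^T]linearZ /= -!scalemxAl -scalemxAr !mxE !mulf_neq0 //.
  + by rewrite gt_eqF // expinv_gt0 // exprn_gt0.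
  + by rewrite gt_eqF // expinv_gt0 // exprn_gt0.
  + by move: xi0; rewrite mxE.
move=> N y; rewrite BE; have [->|->] := stair_flat_or N h y.
  by rewrite trmx0 !mul0mx mxE.
by rewrite mulmx0 mxE.
Qed.

End PartB.

(** * The barrier argument *)

Lemma continuous_normr (R : realType) (T : topologicalType) (f : T -> R) (x : T) :
  {for x, continuous f} -> {for x, continuous (fun y => `|f y|)}.
Proof. by move=> fc; exact: (cvg_norm fc). Qed.

Section Barrier.
Context {R : realType} {n : nat}.
Implicit Types (p q h x y : 'rV[R]_n) (A : set 'rV[R]_n).

(** The bound on backward increments is what an interior or exit-face maximum
    provides; the quadratic error in [s] disappears in the limit. *)
Lemma derive_ge (V : normedModType R) (G : V -> R) (p v : V) (C D : R) :
  derivable G p v ->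
  (\forall s \near (0 : R)^'+, G (p - s *: v) - G p <= s * (C + s * D)) ->
  - C <= 'D_v G p.
Proof.
move=> Gd Gs; apply/ler_addgt0Pl => eps eps0.
have e2 : 0 < eps / 2 by rewrite divr_gt0.
have /cvgrPdist_le /(_ _ e2) := Gd; rewrite -/('D_v G p) => H.
have H' : \forall s \near (0 : R)^'+,
  `|'D_v G p - (- s)^-1 *: ((G \o shift p) ((- s) *: v) - G p)| <= eps / 2.
  move: H => /nbhs_ballP[r /= r0 rP]; near=> s.
  have s0 : 0 < s by near: s; exact: nbhs_right_gt.
  apply: rP; last by rewrite oppr_eq0 gt_eqF.
  rewrite /ball /= sub0r opprK gtr0_norm //; near: s; exact: nbhs_right_lt.
have D1 : 0 < `|D| + 1 by rewrite ltr_wpDl.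
have D2 : 0 < eps / 2 / (`|D| + 1) by rewrite divr_gt0.
near (0 : R)^'+ => s.
have s0 : 0 < s by near: s; exact: nbhs_right_gt.
have sD : s * `|D| <= eps / 2.
  have : s <= eps / 2 / (`|D| + 1) by near: s; exact: nbhs_right_le.
  by rewrite ler_pdivlMr // mulrDr; have := normr_ge0 D; lra.
have : `|'D_v G p - (- s)^-1 *: ((G \o shift p) ((- s) *: v) - G p)| <= eps / 2.
  by near: s.
have : G (p - s *: v) - G p <= s * (C + s * D) by near: s.
rewrite /= scaleNr [- _ + p]addrC => H1; rewrite ler_norml => /andP[H2 _].
move: H2; rewrite invrN [- _ *: _]mulNr opprK.
set q := G _ - G p in H1 *.
have : s^-1 * q <= C + s * D by rewrite mulrC ler_pdivrMr // mulrC.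
have := ler_wpM2l (ltW s0) (ler_norm D).
lra.
Unshelve. all: by end_near. Qed.

Definition dot x y : R := \sum_j x 0 j * y 0 j.

Lemma sumsqB x y (s : R) :
  sumsq (x - s *: y) = sumsq x - 2 * s * dot x y + s ^+ 2 * sumsq y.
Proof.
rewrite /sumsq /dot !mulr_sumr -sumrB -big_split; apply: eq_bigr => j _ /=.
by rewrite !mxE; ring.
Qed.

Lemma dot_bound x y : `|dot x y| <= n%:R * `|x| * `|y|.
Proof.
rewrite (le_trans (ler_norm_sum _ _ _)) //.
apply: (@le_trans _ _ (\sum_(j < n) `|x| * `|y|)).
  by apply: ler_sum => j _; rewrite normrM ler_pM ?rV_coord_norm.
by rewrite sumr_const card_ord -mulrA mulr_natl.
Qed.

Lemma sumsq_ge0 x : 0 <= sumsq x.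
Proof. by apply: sumr_ge0 => j _; exact: sqr_ge0. Qed.

Context (v0 : 'rV[R]_n) (c : 'I_n -> R) (cv0 : linform c v0 = 1).

(** The projection along [v0] onto the kernel of [linform c]; so [linform c] and
    [transverse] are the longitudinal and transverse coordinates of the tube. *)
Definition transverse h : 'rV[R]_n := h - linform c h *: v0.

Lemma transverse_v0 : transverse v0 = 0.
Proof. by rewrite /transverse cv0 scale1r subrr. Qed.

Lemma transverseB x y (s : R) :
  transverse (x - s *: y) = transverse x - s *: transverse y.
Proof.
have L : linform c (x - s *: y) = linform c x - s * linform c y.
  by rewrite linearB linearZ.
by rewrite /transverse L; apply/rowP => j; rewrite !mxE; ring.
Qed.

Lemma linform_norm : exists2 M : R, 0 <= M & forall h, `|linform c h| <= M * `|h|.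
Proof.
exists (\sum_i `|c i|); first exact: sumr_ge0.
move=> h; rewrite (le_trans (ler_norm_sum _ _ _)) // mulr_suml.
by apply: ler_sum => i _; rewrite normrM mulrC ler_wpM2l // rV_coord_norm.
Qed.

Definition tube p0 (T d : R) : set 'rV[R]_n :=
  [set p | `|linform c (p - p0)| <= T /\ sumsq (transverse (p - p0)) <= d ^+ 2].

Lemma tube_norm p0 (T d : R) p : 0 <= d -> tube p0 T d p ->
  `|p - p0| <= T * `|v0| + d.
Proof.
move=> d0 [pT pd]; rewrite -[p - p0](subrK (linform c (p - p0) *: v0)) addrC.
rewrite (le_trans (ler_normD _ _)) // lerD // ?normrZ ?ler_wpM2r //.
exact: sumsq_norm.
Qed.

Lemma shifted_linform_continuous (k : 'I_n -> R) p0 :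
  continuous (fun p => linform k (p - p0)).
Proof.
move=> p; rewrite (_ : (fun p => _) = (fun p => linform k p - linform k p0)); last first.
  by apply/funext => q; rewrite linearB.
by apply: continuousB; [exact: linform_continuous|exact: cst_continuous].
Qed.

Lemma shifted_sumsq_continuous p0 : continuous (fun p => sumsq (transverse (p - p0))).
Proof.
move=> p; apply: continuous_sum => j.
have C : {for p, continuous (fun q => (transverse (q - p0)) 0 j)}.
  rewrite (_ : (fun q => _) = (fun q => linform (fun i => (i == j)%:R) (q - p0)
      - linform c (q - p0) * v0 0 j)); last first.
    by apply/funext => q; rewrite linform_coord !mxE.
  apply: continuousB; first exact: shifted_linform_continuous.
  by apply: continuousM; [exact: shifted_linform_continuous|exact: cst_continuous].
exact: (continuousM C C).
Qed.

Lemma tube_compact p0 (T d : R) : 0 <= d -> compact (tube p0 T d).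
Proof.
move=> d0; apply: bounded_closed_compact.
  exists (T * `|v0| + d + `|p0|); split; first exact: num_real.
  move=> M HM p /(tube_norm d0) pT; apply: le_trans (ltW HM).
  by rewrite -[p](subrK p0) (le_trans (ler_normD _ _)) // lerD2r.
have C : continuous (fun p => `|linform c (p - p0)|).
  move=> p; apply: (@continuous_normr R _ (fun p => linform c (p - p0)) p).
  exact: shifted_linform_continuous.
rewrite (_ : tube p0 T d = (fun p => `|linform c (p - p0)|) @^-1` [set t | t <= T] `&`
  (fun p => sumsq (transverse (p - p0))) @^-1` [set t | t <= d ^+ 2]) //.
apply: closedI.
  apply: closed_comp => [p _|]; last exact: closed_le.
  exact: C.
apply: closed_comp => [p _|]; last exact: closed_le.
exact: shifted_sumsq_continuous.
Qed.

(** At the centre of the exit face, [Phi >= beta * T - eps].  On the entry face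
    [Phi <= eps - beta * T] and on the lateral boundary
    [Phi <= eps + beta * T - P], both of which are smaller.  The exit face
    itself is not excluded. *)
Lemma barrier_max (G : 'rV[R]_n -> R) p0 (T d eps beta P : R) :
  0 < T -> 0 < d -> eps < beta * T -> 0 < beta -> 0 < eps -> 2 * eps < P ->
  (forall p, tube p0 T d p -> {for p, continuous G} /\ `|G p| <= eps) ->
  let Phi p := G p + beta * linform c (p - p0)
               - P / d ^+ 2 * sumsq (transverse (p - p0)) in
  exists p, [/\ tube p0 T d p, - T < linform c (p - p0),
    sumsq (transverse (p - p0)) < d ^+ 2 &
    forall q, tube p0 T d q -> Phi q <= Phi p].
Proof.
move=> T0 d0 bT b0 eps0 P2 GA Phi.
have d20 : 0 < d ^+ 2 by rewrite exprn_gt0.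
have [|||p] := @EVT_max_rV R n Phi (tube p0 T d).
- exists p0; split; rewrite subrr; first by rewrite linear0 normr0 ltW.
  by rewrite /transverse linear0 scale0r subrr sumsq0 ltW.
- exact/tube_compact/ltW.
- apply: continuous_in_subspaceT => p; rewrite inE => /GA[Gp _].
  suff : {for p, continuous Phi} by [].
  rewrite /Phi; apply: continuousB; first apply: continuousD => //.
    apply: continuousM; first exact: cst_continuous.
    exact: shifted_linform_continuous.
  apply: continuousM; first exact: cst_continuous.
  exact: shifted_sumsq_continuous.
rewrite inE => pD pmax.
have [pT pd] := pD; have [_ Gp] := GA _ pD.
pose p1 := T *: v0 + p0.
have p1E : p1 - p0 = T *: v0 by rewrite /p1 addrK.
have lZ : linform c (T *: v0) = T by rewrite linearZ /= cv0 [T *: 1]mulr1.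
have tr1 : transverse (p1 - p0) = 0.
  by rewrite p1E /transverse lZ subrr.
have l1 : linform c (p1 - p0) = T by rewrite p1E.
have p1D : tube p0 T d p1.
  by split; rewrite ?tr1 ?sumsq0 ?l1 ?(gtr0_norm T0) // ltW.
have [_ G1] := GA _ p1D.
have := pmax p1; rewrite inE => /(_ p1D); rewrite /Phi tr1 sumsq0 mulr0 subr0 l1 => Hp.
move: Gp G1 pT; rewrite !ler_norml => /andP[Gp1 Gp2] /andP[G11 G12] /andP[pT1 pT2].
have Pd : 0 <= P / d ^+ 2 * sumsq (transverse (p - p0)).
  by rewrite mulr_ge0 ?sumsq_ge0 // divr_ge0 ?ltW // (le_lt_trans _ P2) // mulr_ge0 // ltW.
have bl : beta * linform c (p - p0) <= beta * T by rewrite ler_pM2l.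
exists p; split => //.
- rewrite lt_neqAle pT1 andbT; apply/eqP => lT; move: Hp Pd.
  rewrite -lT mulrN; lra.
- rewrite lt_neqAle pd andbT; apply/eqP => lT; move: Hp.
  rewrite lT divfK ?gt_eqF //; lra.
- by move=> q qD; apply: pmax; rewrite inE.
Qed.

(** For small [s > 0] the point [p - s *: w] is still in the tube, because
    [linform c w > 0] and [p] is off the entry face and the lateral boundary.
    Comparing [Phi] there with its maximum bounds the backward increment of
    [G]; on the exit face this comparison is available in that direction
    only. *)
Lemma barrier_derive (G : 'rV[R]_n -> R) p0 p w (T d beta P : R) :
  tube p0 T d p -> - T < linform c (p - p0) -> sumsq (transverse (p - p0)) < d ^+ 2 ->
  (let Phi p := G p + beta * linform c (p - p0)
               - P / d ^+ 2 * sumsq (transverse (p - p0)) in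
   forall q, tube p0 T d q -> Phi q <= Phi p) ->
  0 < linform c w -> derivable G p w ->
  - (beta * linform c w - 2 * (P / d ^+ 2) * dot (transverse (p - p0)) (transverse w))
    <= 'D_w G p.
Proof.
move=> [pT pd] pT' pd' pmax lw Gd.
apply: (@derive_ge _ _ _ _ _ (P / d ^+ 2 * sumsq (transverse w))) => //.
set x := transverse (p - p0) in pd pd' pmax *; set y := transverse w.
have E (s : R) : p - s *: w - p0 = (p - p0) - s *: w by rewrite addrAC.
have El (s : R) : linform c (p - p0 - s *: w) = linform c (p - p0) - s * linform c w.
  by rewrite linearB linearZ.
have lT : 0 < (T + linform c (p - p0)) / linform c w by rewrite divr_gt0 // -ltrBlDl sub0r.
pose B := 2 * `|dot x y| + sumsq y + 1.
have B0 : 0 < B by rewrite ltr_wpDl // addr_ge0 ?sumsq_ge0 // mulr_ge0.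
have dB : 0 < (d ^+ 2 - sumsq x) / B by rewrite divr_gt0 // subr_gt0.
near=> s.
have s0 : 0 < s by near: s; exact: nbhs_right_gt.
have s1 : s <= 1 by near: s; exact: nbhs_right_le.
have sT : s <= (T + linform c (p - p0)) / linform c w by near: s; exact: nbhs_right_le.
have sB : s <= (d ^+ 2 - sumsq x) / B by near: s; exact: nbhs_right_le.
move: sT sB; rewrite !ler_pdivlMr // => sT sB.
have slw : 0 < s * linform c w by rewrite mulr_gt0.
have sdot : s * dot x y <= s * `|dot x y| by rewrite ler_pM2l // ler_norm.
have sdotN : - (s * dot x y) <= s * `|dot x y| by rewrite -mulrN ler_pM2l // ler_normr lexx orbT.
have s2 : s ^+ 2 * sumsq y <= s * sumsq y.
  by rewrite ler_wpM2r ?sumsq_ge0 // expr2 ler_piMl // ltW.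
have D : tube p0 T d (p - s *: w).
  split; rewrite E ?El.
    by move: pT; rewrite !ler_norml => /andP[? ?]; apply/andP; split; lra.
  rewrite transverseB sumsqB -/x -/y; move: sB; rewrite /B !mulrDr => sB.
  have := sumsq_ge0 y; lra.
have := pmax _ D; rewrite E El transverseB sumsqB -/x -/y => H.
rewrite -subr_ge0 in H; rewrite -subr_ge0; apply: le_trans H _; rewrite le_eqVlt; apply/orP; left; apply/eqP.
by ring.
Unshelve. all: by end_near. Qed.

End Barrier.

Section QuasiMax.
Context {R : realType} {n : nat}.
Implicit Types (p q h x y v : 'rV[R]_n) (A : set 'rV[R]_n).

Lemma normalizing_linform v : v != 0 -> exists c : 'I_n -> R, linform c v = 1.
Proof.
move=> v0; have [i vi] : exists i, v 0 i != 0.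
  apply: contrapT => H; move/eqP: v0; apply; apply/rowP => i; rewrite mxE.
  by apply/eqP/negP => /negP vi; apply: H; exists i.
exists (fun j => (j == i)%:R / v 0 i).
rewrite /linform (bigD1 i) //= eqxx mul1r divff // big1 ?addr0 // => j.
by move=> /negbTE ->; rewrite mul0r mulr0.
Qed.

(** In the tube the Hessian is evaluated at [t *: v + x] with [x] short: apart
    from [- a * t ^ 2], the terms carry a factor [eta], the ratio of the
    radius of the tube to its half-length. *)
Lemma bil_lower (H : 'M[R]_n) (M a t T eta : R) v x :
  (forall x y, `|bil H x y| <= M * `|x| * `|y|) -> 0 <= M ->
  bil H v v = - a -> 0 <= a -> `|t| <= T -> `|x| <= eta * T -> 0 <= T -> 0 <= eta <= 1 ->
  - (a + M * eta * (2 * `|v| + 1)) * T ^+ 2 <= bil H (t *: v + x) (t *: v + x).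
Proof.
move=> HM M0 Hv a0 tT xT T0 /andP[eta0 eta1].
rewrite bilDl !bilDr !bilZl !bilZr Hv.
have etaT : 0 <= eta * T by rewrite mulr_ge0.
have H1 : `|bil H v x| <= M * `|v| * (eta * T).
  by apply: (le_trans (HM v x)); rewrite ler_wpM2l // mulr_ge0.
have H2 : `|bil H x v| <= M * `|v| * (eta * T).
  apply: (le_trans (HM x v)).
  by rewrite mulrAC ler_wpM2l // mulr_ge0.
have H3 : `|bil H x x| <= M * eta * T ^+ 2.
  apply: (le_trans (HM x x)); apply: (@le_trans _ _ (M * (eta * T) * (eta * T))).
    by rewrite ler_pM ?mulr_ge0 // ler_wpM2l.
  have -> : M * (eta * T) * (eta * T) = M * eta * T ^+ 2 * eta by ring.
  by rewrite ler_piMr // !mulr_ge0 // sqr_ge0.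
have B0 : 0 <= M * `|v| * (eta * T) by rewrite !mulr_ge0.
have T1 : `|t * bil H v x| <= T * (M * `|v| * (eta * T)) by rewrite normrM ler_pM.
have T2 : `|t * bil H x v| <= T * (M * `|v| * (eta * T)) by rewrite normrM ler_pM.
have tt : t * (t * a) <= T ^+ 2 * a.
  rewrite mulrA -expr2 ler_wpM2r // -real_normK ?num_real //.
  by rewrite lerXn2r ?nnegrE.
have E : - (a + M * eta * (2 * `|v| + 1)) * T ^+ 2 =
  - (T ^+ 2 * a) - T * (M * `|v| * (eta * T)) - T * (M * `|v| * (eta * T)) - M * eta * T ^+ 2.
  by ring.
rewrite E; move: T1 T2 H3; rewrite !ler_norml => /andP[? _] /andP[? _] /andP[? _].
by rewrite !mulrN; lra.
Qed.

Lemma nearby_velocity (c : 'I_n -> R) v0 W (L w : R) :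
  linform c v0 = 1 -> 0 <= L -> (forall h, `|linform c h| <= L * `|h|) ->
  `|W - v0| <= w ->
  `|linform c W - 1| <= L * w /\ `|transverse v0 c W| <= w * (1 + L * `|v0|).
Proof.
move=> cv0 L0 HL Ww.
have lW : `|linform c (W - v0)| <= L * w.
  by apply: (le_trans (HL (W - v0))); rewrite ler_wpM2l.
split; first by rewrite -[X in linform c W - X]cv0 -linearB.
have -> : transverse v0 c W = transverse v0 c (W - 1 *: v0).
  by rewrite transverseB transverse_v0 // scaler0 subr0.
rewrite scale1r mulrDr mulr1 mulrA [w * L]mulrC.
by rewrite (le_trans (ler_normB _ _)) // normrZ lerD // ler_wpM2r.
Qed.

(** The Euclidean form of the lower bound, with [a * T ^ 3] in the role of
    [eps].  In units of [a * T ^ 2] the losses are [1/2 + 1/40 + 1/40] from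
    [u] (Hessian along [V p0], its other entries, Taylor remainder),
    [(101/100) ^ 2] from the slope [beta] of the barrier and [1/100] from its
    transverse part, for a total below [8/5].  The ratio [eta], the Taylor
    precision [kap] and the bound [w] on the variation of [V] are fixed first,
    and make these losses valid for all small [T]. *)
Lemma quasi_max A p0 (u : 'rV[R]_n -> R) (V : 'rV[R]_n -> 'rV[R]_n) (a : R) :
  open A -> A p0 -> Ck 2 A u -> (forall j, partial j u p0 = 0) -> V p0 != 0 ->
  (forall w : R, 0 < w -> \forall p \near p0, `|V p - V p0| <= w) ->
  0 < a -> bil (hess u p0) (V p0) (V p0) = - a ->
  exists2 T0 : R, 0 < T0 & forall T, 0 < T < T0 -> forall G : 'rV[R]_n -> R,
    (forall p, A p -> differentiable G p /\ `|G p| <= a * T ^+ 3) ->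
    exists2 p, A p & u p0 - 8 / 5 * a * T ^+ 2 <= u p + 'D_(V p) G p.
Proof.
move=> Ao Ap0 uk du0 V0 Vc a0 Ha.
set v0 := V p0 in V0 Vc Ha *; set H := hess u p0 in Ha *.
have [c cv0] := normalizing_linform V0.
have [M M0 HM] := bil_bound H; have [L L0 HL] := linform_norm c.
pose m := `|v0| + 1; have m0 : 0 < m by rewrite ltr_wpDl.
pose K := 20 * (M + 1) * (2 * `|v0| + 1).
have v00 := normr_ge0 v0.
have K0 : 0 < K by rewrite !mulr_gt0 //; lra.
pose eta := a / (a + K).
have aK0 : 0 < a + K by rewrite addr_gt0.
have eta0 : 0 < eta by rewrite divr_gt0.
have eta1 : eta <= 1 by rewrite ler_pdivrMr // mul1r lerDl ltW.
have etaM : M * eta * (2 * `|v0| + 1) <= a / 20.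
  have -> : M * eta * (2 * `|v0| + 1) = a * (M * (2 * `|v0| + 1)) / (a + K).
    by rewrite /eta; field; rewrite gt_eqF.
  rewrite ler_pdivrMr // -mulrA ler_pM2l // [20^-1 * _]mulrC ler_pdivlMr //; apply: (@le_trans _ _ K); last by rewrite lerDr ltW.
  by rewrite /K; have := mulr_ge0 M0 v00; lra.
pose kap := a / (40 * m ^+ 2).
have kap0 : 0 < kap by rewrite divr_gt0 // mulr_gt0 // exprn_gt0.
(* The constant is hidden behind a variable because closing side conditions
   would compute with its unary representation. *)
have [N NE] : exists N : R, N = 600 by exists 600.
have N0 : 0 < N by rewrite NE ltr0n.
pose w := eta / (N * n.+1%:R * (1 + L * m)).
have Lm : 0 <= L * m by rewrite mulr_ge0 // ltW.
have w0 : 0 < w by rewrite divr_gt0 // !mulr_gt0 // ltr_wpDr.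
have n1 : 1 <= n.+1%:R :> R by rewrite ler1n.
have wE : w * (1 + L * m) = eta / (N * n.+1%:R).
  by rewrite /w; field; rewrite !gt_eqF // ltr_wpDr.
have Lw : L * w <= 1 / 100.
  apply: (@le_trans _ _ (w * (1 + L * m))).
    rewrite mulrC ler_pM2l // /m mulrDr mulr1 addrA lerDr.
    by rewrite addr_ge0 // mulr_ge0.
  rewrite wE ler_pdivrMr ?mulr_gt0 // NE.
  by move: eta1 n1; clear; lra.
have Lv : w * (1 + L * `|v0|) <= eta / (N * n.+1%:R).
  by rewrite -wE ler_pM2l // lerD2l ler_wpM2l // /m lerDl.
have [r r0 rP] := taylor2 Ao uk Ap0 kap0 du0.
have [r' r'0 r'P] : exists2 r' : R, 0 < r' & forall p, `|p - p0| < r' -> `|V p - v0| <= w.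
  have /nbhs_ballP[r' /= r'0 r'P] := Vc _ w0; exists r' => // p pr; apply: r'P.
  by rewrite -ball_normE /= distrC.
have rr0 : 0 < Num.min r r' by rewrite lt_min r0.
exists (Num.min r r' / m); first by rewrite divr_gt0.
move=> T /andP[T0]; rewrite ltr_pdivlMr // lt_min => /andP[Tr Tr'] G HG.
have etaT : 0 < eta * T by rewrite mulr_gt0.
have tubeT p : tube v0 c p0 T (eta * T) p -> `|p - p0| <= T * m.
  move=> /(tube_norm (ltW etaT)) H1; apply: le_trans H1 _.
  by rewrite /m mulrDr mulr1 lerD2l ler_piMl // ltW.
have tubeA p : tube v0 c p0 T (eta * T) p -> A p.
  move=> /tubeT H1; have [] := rP (p - p0) (le_lt_trans H1 Tr).
  by rewrite subrK.
have T20 : 0 < T ^+ 2 by rewrite exprn_gt0.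
have T30 : 0 < T ^+ 3 by rewrite exprn_gt0.
have aT2 : 0 < a * T ^+ 2 by rewrite mulr_gt0.
have aT3 : 0 < a * T ^+ 3 by rewrite mulr_gt0.
have E3 : a * T ^+ 2 * T = a * T ^+ 3 by ring.
pose beta := 101 / 100 * (a * T ^+ 2).
have bT : a * T ^+ 3 < beta * T.
  by rewrite /beta -mulrA E3; move: aT3; clear; lra.
have b0 : 0 < beta by rewrite mulr_gt0.
have P2 : 2 * (a * T ^+ 3) < 3 * (a * T ^+ 3).
  by rewrite ltr_pM2r // ltr_nat.
have GT p : tube v0 c p0 T (eta * T) p -> {for p, continuous G} /\ `|G p| <= a * T ^+ 3.
  by move=> /tubeA/HG[Gd Gp]; split => //; exact: differentiable_continuous.
have [p [pT pT1 pT2 pmax]] := barrier_max cv0 T0 etaT bT b0 aT3 P2 GT.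
have Ap := tubeA p pT; exists p => //; have [Gd _] := HG p Ap.
have pm := tubeT _ pT.
have Vw := r'P p (le_lt_trans pm Tr').
have [_ ptay] := rP (p - p0) (le_lt_trans pm Tr); rewrite subrK in ptay.
set W := V p in Vw *.
have [lW yW] := nearby_velocity cv0 L0 HL Vw.
have {}lW := le_trans lW Lw; have {}yW := le_trans yW Lv.
have lW0 : 0 < linform c W.
  by move: lW; rewrite ler_norml => /andP[+ _]; clear; lra.
have lW1 : linform c W <= 101 / 100.
  by move: lW; rewrite ler_norml => /andP[_]; clear; lra.
set x := transverse v0 c (p - p0) in pT2 pmax.
have xT : `|x| <= eta * T by apply: sumsq_norm; [exact: ltW|exact: ltW].
have dot_le : `|dot x (transverse v0 c W)| <= eta ^+ 2 * T / N.
  apply: (le_trans (dot_bound x (transverse v0 c W))).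
  apply: (@le_trans _ _ (n%:R * (eta * T) * (eta / (N * n.+1%:R)))).
    by rewrite ler_pM // ?mulr_ge0 // ler_wpM2l.
  have -> : n%:R * (eta * T) * (eta / (N * n.+1%:R)) =
      eta ^+ 2 * T / N * (n%:R / n.+1%:R).
    by set q : R := n.+1%:R; have q0 : 0 < q by []; field; rewrite !gt_eqF.
  rewrite ler_piMr //.
    by apply: divr_ge0; [apply: mulr_ge0; [exact: sqr_ge0|exact: ltW]|exact: ltW].
  by rewrite ler_pdivrMr // mul1r ler_nat.
have GW : derivable G p W by exact: diff_derivable.
have Hd := barrier_derive pT pT1 pT2 pmax lW0 GW.
rewrite -/x in Hd.
have Hdot : 2 * (3 * (a * T ^+ 3) / (eta * T) ^+ 2) * dot x (transverse v0 c W)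
    >= - (a * T ^+ 2 / 100).
  rewrite lerNl -mulrN.
  apply: (@le_trans _ _ (2 * (3 * (a * T ^+ 3) / (eta * T) ^+ 2) * (eta ^+ 2 * T / N))).
    rewrite ler_wpM2l //.
      apply: mulr_ge0 => //; apply: divr_ge0; last exact: sqr_ge0.
      by apply: mulr_ge0 => //; exact: ltW.
    by apply: le_trans dot_le; rewrite ler_normr lexx orbT.
  have -> : 2 * (3 * (a * T ^+ 3) / (eta * T) ^+ 2) * (eta ^+ 2 * T / N) = a * T ^+ 2 * 6 / N.
    by field; rewrite !gt_eqF.
  by rewrite NE; move: aT2; clear; lra.
have blW : beta * linform c W <= beta * (101 / 100) by rewrite ler_pM2l.
have hE : p - p0 = linform c (p - p0) *: v0 + x by rewrite /x /transverse [RHS]addrC subrK.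
have [lT _] := pT.
have etaI : 0 <= eta <= 1 by rewrite eta1 ltW.
have := bil_lower HM M0 Ha (ltW a0) lT xT (ltW T0) etaI; rewrite -hE => Hb.
have Hb2 : - (a + a / 20) * T ^+ 2 <= bil H (p - p0) (p - p0).
  by apply: le_trans Hb; rewrite ler_wpM2r ?(ltW T20) // lerN2 lerD2l.
have Hk : kap * `|p - p0| ^+ 2 <= a * T ^+ 2 / 40.
  apply: (@le_trans _ _ (kap * (T * m) ^+ 2)).
    rewrite ler_pM2l // lerXn2r ?nnegrE // mulr_ge0 // ltW //.
  rewrite /kap le_eqVlt; apply/orP; left; apply/eqP; field.
  by rewrite gt_eqF.
move: ptay; rewrite ler_norml => /andP[ptay _].
have E : - (a + a / 20) * T ^+ 2 = - (21 / 20 * (a * T ^+ 2)) by field.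
rewrite {}E in Hb2; move: Hd blW ptay Hk Hb2 Hdot aT2.
rewrite /beta -[8 / 5 * a * T ^+ 2]mulrA.
by clear; set dd := _ * dot _ _; lra.
Qed.

End QuasiMax.

(** * The lower bound for the perturbed derivative *)

Section PartA.
Context {R : realType} {n : nat} (X : manifold R n).
Implicit Types (f g h : smooth_fun X).

Lemma rV_near (V : 'rV[R]_n -> 'rV[R]_n) (p0 : 'rV[R]_n) :
  (forall j, {for p0, continuous (fun p => V p 0 j)}) ->
  forall w : R, 0 < w -> \forall p \near p0, `|V p - V p0| <= w.
Proof.
move=> Vc w w0.
near=> p; apply: rV_norm_le; first exact: ltW.
move=> j; rewrite !mxE distrC; move: j; near: p; apply: filter_forall => j.
by have /cvgrPdist_le/(_ _ w0) := Vc j.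
Unshelve. all: by end_near. Qed.

(** Differentiating [\sum_j V_j * partial j u] along [V p0], the derivatives of
    the coefficients [V_j] are multiplied by [partial j u p0 = 0]. *)
Lemma derive_field (A : set 'rV[R]_n) (V : 'rV[R]_n -> 'rV[R]_n) (u g : 'rV[R]_n -> R) p0 :
  open A -> A p0 -> Ck 2 A u -> (forall j, partial j u p0 = 0) ->
  (forall j, Ck 1 A (fun p => V p 0 j)) ->
  (forall p, A p -> g p = 'D_(V p) u p) ->
  'D_(V p0) g p0 = bil (hess u p0) (V p0) (V p0).
Proof.
move=> Ao Ap0 uk du0 Vk gE.
have nE : {near p0, g =1 \sum_j (fun p => V p 0 j * partial j u p)}.
  have : nbhs p0 A by exact: open_nbhs_nbhs.
  apply: filterS => p Ap; rewrite gE // derive_partials ?fct_sumE //.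
  exact: (Ck_differentiable Ao uk Ap).
have Vd j : derivable (fun p => V p 0 j) p0 (V p0).
  exact/diff_derivable/(Ck_differentiable Ao (Vk j) Ap0).
have ud j : differentiable (partial j u) p0.
  exact: (Ck_differentiable Ao (Ck_partial j uk) Ap0).
have ud' j : derivable (partial j u) p0 (V p0) by exact: diff_derivable.
rewrite (near_eq_derive _ nE) derive_sum => [|j]; last exact: derivableM.
rewrite bilE; apply: eq_bigr => j _.
rewrite deriveM // du0 scale0r addr0 derive_partials //.
rewrite [LHS]mulrC /linform; congr (_ * _); apply: eq_bigr => i _.
by rewrite [in RHS]mxE.
Qed.

(** [8/5] is admissible since [(8/5) ^ 3 = 4.096 < 9/2]. *)
Lemma cube_root_bound (a eps T : R) : 0 < a -> 0 < eps ->
  T = eps `^ (1/3) / a `^ (1/3) ->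
  [/\ 0 < T, a * T ^+ 3 = eps &
    8 / 5 * a * T ^+ 2 <= (9 / 2) `^ (1 / 3) * a `^ (1 / 3) * eps `^ (2 / 3)].
Proof.
move=> a0 e0 TE.
have cube (x : R) : 0 < x -> (x `^ (1/3)) ^+ 3 = x.
  move=> x0; rewrite -powR_mulrn ?powR_ge0 // -powRrM.
  by rewrite (_ : 1/3 * 3%:R = 1) ?powRr1 ?ltW //; field.
have b0 : 0 < a `^ (1/3) by rewrite powR_gt0.
have d0 : 0 < eps `^ (1/3) by rewrite powR_gt0.
have s0 : 0 < (9/2 : R) `^ (1/3) by rewrite powR_gt0.
have b3 := cube a a0; have d3 := cube eps e0.
have s3 := cube (9/2) ltac:(lra).
have sq : eps `^ (2/3) = (eps `^ (1/3)) ^+ 2.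
  by rewrite -powR_mulrn ?powR_ge0 // -powRrM; congr (_ `^ _); field.
rewrite sq.
move: TE b0 d0 s0 b3 d3 s3.
set b := a `^ _; set d := eps `^ _; set s := _ `^ _ => TE b0 d0 s0 b3 d3 s3.
have T0 : 0 < T by rewrite TE divr_gt0.
have dE : d = b * T by rewrite TE mulrC divfK // gt_eqF.
have s85 : 8/5 <= s.
  have : (8/5 : R) ^+ 3 <= s ^+ 3 by rewrite s3; lra.
  by rewrite ler_pXn2r // nnegrE ?(ltW s0).
split => //; first by rewrite -b3 -d3 dE exprMn.
rewrite dE -b3 exprMn.
have -> : s * b * (b ^+ 2 * T ^+ 2) = s * (b ^+ 3 * T ^+ 2) by ring.
rewrite -mulrA ler_wpM2r //.
by rewrite mulr_ge0 // exprn_ge0 // ltW.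
Qed.

(** In the chart at [x] this is [quasi_max] for [u = lam f] and [G = F - f], on a
    neighborhood of [x] which the chart sends into [U].  If the field vanishes
    at [x], the point [x] itself gives the bound. *)
Lemma sup_derivative_lower_bound (lam : smooth_fun X -> smooth_fun X) (f : smooth_fun X) (x : X)
      (U : set X) :
    diffop1 lam ->
    (forall y : X, lam f y <= lam f x) ->
    nondegenerate_critical_point (lam f) x ->
    open U -> U x ->
    exists K eps0 : R, [/\ 0 < K, 0 < eps0 &
      forall eps : R, 0 < eps < eps0 ->
      forall F : smooth_fun X,
      (supnorm U (fun y => F y - f y)%R <= eps%:E)%E ->
      ((lam f x
        - (9 / 2) `^ (1 / 3) * (- lam (lam (lam f)) x) `^ (1 / 3)
          * eps `^ (2 / 3)
        - K * eps)%:E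
       <= ereal_sup [set (lam F y)%:E | y in U])%E].
Proof.
move=> [v vS lamE] fmax [du Hu] Uo Ux.
set c := chart_at x; set p0 := c x.
have cA : atlas c by exact: chart_at_atlas.
have cx : dom c x by exact: dom_chart_at.
pose A := c @` dom c; have Ap0 : A p0 by exists x.
have cp0 : cinv c p0 = x by rewrite coordK ?inE.
pose V p := v (cinv c p) *m jac_to c (cinv c p).
have lamc g p : A p -> lam g (cinv c p) = 'D_(V p) (g \o cinv c) p.
  by move=> Ap; rewrite (diffop1_chart _ lamE cA Ap).
have sup_ge (F : smooth_fun X) y (r : R) : U y -> r <= lam F y ->
    (r%:E <= ereal_sup [set (lam F y)%:E | y in U])%E.
  move=> Uy ry; apply: (@le_trans _ _ (lam F y)%:E); first by rewrite lee_fin.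
  by apply: ereal_sup_ubound; exists y.
have [V0|V0] := eqVneq (V p0) 0.
  have lam0 g : lam g x = 0 by rewrite -cp0 lamc // V0 derive0.
  exists 1, 1; split => // eps /andP[eps0 _] F _.
  apply: (sup_ge F x) => //; rewrite !lam0 sub0r [1 * eps]mul1r -opprD oppr_le0.
  apply: addr_ge0; last exact: ltW.
  by apply: mulr_ge0; [apply: mulr_ge0|]; exact: powR_ge0.
have Ao : open A by exact: open_coord.
pose u := lam f \o cinv c.
have : nbhs p0 [set q | A q /\ U (cinv c q)].
  have H1 : nbhs p0 A by exact: open_nbhs_nbhs.
  have H2 : nbhs p0 [set q | U (cinv c q)].
    apply: (near_continuous (g := cinv c) (P := U)).
      by apply: cinv_continuous; rewrite inE.
    by rewrite cp0; apply: open_nbhs_nbhs.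
  by apply: filterI.
rewrite nbhsE => -[B [Bo Bp0] BAU].
have BA : B `<=` A by move=> q /BAU [].
have uk : Ck 2 B u by apply: Ck_subset BA _; exact: smooth_Ck.
have umax q : B q -> u q <= u p0 by move=> _; rewrite /u /= cp0; exact: fmax.
have du0 j : partial j u p0 = 0.
  by have /colP/(_ j) := du; rewrite !mxE.
have hU : hess u p0 \in unitmx.
  by rewrite (_ : hess u p0 = hessian (lam f) x) //; apply/matrixP => i j; rewrite !mxE.
have Vk k j : Ck k A (fun p => V p 0 j) by exact: (vS c cA j k).
have Hneg := hess_neg Bo uk Bp0 umax du0 hU V0.
have lam3 : lam (lam (lam f)) x = bil (hess u p0) (V p0) (V p0).
  rewrite -{1}cp0 lamc //.
  apply: (derive_field Bo Bp0 uk du0) => [j|p /BA Ap].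
    by apply: Ck_subset BA _; exact: Vk.
  exact: lamc.
set a := - lam (lam (lam f)) x.
have a0 : 0 < a by rewrite /a lam3 oppr_gt0.
have Ha : bil (hess u p0) (V p0) (V p0) = - a by rewrite /a lam3 opprK.
have Vc := rV_near (fun j => Ck_continuous (Vk 0%N j) Ap0).
have [T0 T00 HT] := quasi_max Bo Bp0 uk du0 V0 Vc a0 Ha.
exists 1, (a * T0 ^+ 3); split => //; first by rewrite mulr_gt0 // exprn_gt0.
move=> eps /andP[eps0 epsT] F Feps.
have [T_gt0 aT bound] := cube_root_bound a0 eps0 (erefl _).
set T := eps `^ _ / a `^ _ in T_gt0 aT bound.
have TT0 : T < T0.
  rewrite -(@ltr_pXn2r _ 3) ?nnegrE ?(ltW T_gt0) ?(ltW T00) //.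
  by rewrite -(ltr_pM2l a0) aT.
pose G := (F \o cinv c) - (f \o cinv c).
have dchart (g : smooth_fun X) p : A p -> differentiable (g \o cinv c) p.
  by move=> Ap; exact: (Ck_differentiable Ao (smooth_Ck g 1 cA) Ap).
(* [T] solves [a * T ^ 3 = eps]. *)
have [p Bp Hp] : exists2 p, B p & u p0 - 8 / 5 * a * T ^+ 2 <= u p + 'D_(V p) G p.
  apply: HT => [|p Bp]; first by rewrite T_gt0.
  have [Ap Up] := BAU p Bp; split.
    by apply: differentiableB; exact: dchart.
  rewrite aT -lee_fin; apply: le_trans Feps; apply: ereal_sup_ubound.
  by exists (cinv c p).
have [Ap Up] := BAU p Bp.
apply: (sup_ge F (cinv c p)) => //.
have -> : lam F (cinv c p) = u p + 'D_(V p) G p.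
  rewrite /u /= !lamc // deriveB; [by rewrite addrC subrK|exact/diff_derivable/dchart|exact/diff_derivable/dchart].
apply: le_trans Hp; rewrite [1 * eps]mul1r /u /= cp0 -/a.
apply: (@le_trans _ _ (lam f x - (9 / 2) `^ (1 / 3) * a `^ (1 / 3) * eps `^ (2 / 3))).
  by rewrite gerBl ltW.
by rewrite lerD2l lerN2.
Qed.

End PartA.

Theorem theorem1p3p3 (R : realType) (n : nat) (X : manifold R n) :
  (forall (lam : smooth_fun X -> smooth_fun X) (f : smooth_fun X) (x : X)
      (U : set X),
    diffop1 lam ->
    compactly_supported f ->
    (forall y : X, lam f y <= lam f x) ->
    nondegenerate_critical_point (lam f) x ->
    open U -> U x ->
    exists K eps0 : R, [/\ 0 < K, 0 < eps0 &
      forall eps : R, 0 < eps < eps0 ->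
      forall F : smooth_fun X, compactly_supported F ->
      (supnorm U (fun y => F y - f y)%R <= eps%:E)%E ->
      ((lam f x
        - (9 / 2) `^ (1 / 3) * (- lam (lam (lam f)) x) `^ (1 / 3)
          * eps `^ (2 / 3)
        - K * eps)%:E
       <= ereal_sup [set (lam F y)%:E | y in U])%E])
  /\
  (forall B : smooth_fun X -> smooth_fun X -> smooth_fun X,
    bidiffop1 B ->
    ~ antisymmetric_op B ->
    exists (h : smooth_fun X) (f_ g_ : nat -> smooth_fun X),
      [/\ compactly_supported h,
          forall k, compactly_supported (f_ k) /\ compactly_supported (g_ k),
          supnorm setT (fun y => f_ k y - h y) @[k --> \oo] --> 0%E /\
          supnorm setT (fun y => g_ k y - h y) @[k --> \oo] --> 0%E,
          exists y : X, B h h y != 0 &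
          forall (k : nat) (y : X), B (f_ k) (g_ k) y = 0]).
Proof.
split; last exact: bilinear_approximation.
move=> lam f x U lamD _ fmax crit Uo Ux.
have [K [eps0 [K0 e0 H]]] := sup_derivative_lower_bound lamD fmax crit Uo Ux.
by exists K, eps0; split => // eps He F _; exact: H.
Qed.
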